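(* The radius of the incircle of a triangle, as well as its area and its perimeter, cannot be expressed in radicals of the lengths of this triangle's angle bisectors. That is, for $Q$ being any one of the three quantities (radius of the incircle, area, perimeter), there is no formula in radicals in $l_a,l_b,l_c$ which expresses $Q$ for every triangle with internal angle bisectors of lengths $l_a,l_b,l_c$.
   Context: For a triangle $ABC$ in the Euclidean plane with $BC=a$, $AC=b$, $AB=c$, let $l_a,l_b,l_c$ denote the lengths of the internal angle bisectors (segments from a vertex to the opposite side) drawn to the sides $a,b,c$ respectively. Known facts: for every triple of positive numbers $l_a,l_b,l_c$ there exists a triangle with these angle bisector lengths, and it is unique up to congruence; hence its inradius, area and perimeter are well-defined functions of $(l_a,l_b,l_c)\in(0,\infty)^3$. A formula in radicals in $l_a,l_b,l_c$ is a finite expression built from $l_a,l_b,l_c$ and rational constants using addition, subtraction, multiplication, division and extraction of (complex) $n$-th roots, $n\ge 2$ an integer. It expresses a quantity $Q$ if, for every triple of positive reals $l_a,l_b,l_c$, it is defined and, for some choice of the values of the roots involved, its value equals $Q$. *)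

(* Defs.v *)
From HB Require Import structures.
From mathcomp Require Import all_boot all_order all_algebra.
From mathcomp Require Import complex.
From mathcomp Require Import reals trigo.

Set Implicit Arguments.
Unset Strict Implicit.
Unset Printing Implicit Defensive.

Import Order.TTheory GRing.Theory Num.Theory.
Local Open Scope ring_scope.
Local Open Scope complex_scope.

Section EuclideanPlane.
Variable R : realType.
Implicit Types (u v A B C D P Q X I T : 'rV[R]_2) (r : R).

Definition dot u v : R := \sum_(i < 2) u 0 i * v 0 i.

(* The norm that MathComp-Analysis puts on row vectors is the sup norm, hence
   this explicit Euclidean norm. *)
Definition enorm u : R := Num.sqrt (dot u u).

Definition edist P Q : R := enorm (Q - P).

Definition cross u v : R := u 0 0 * v 0 1 - u 0 1 * v 0 0.

(* Unoriented angle XPY, in [0, pi], for X and Y distinct from P. *)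
Definition angle X P Y : R :=
  acos (dot (X - P) (Y - P) / (enorm (X - P) * enorm (Y - P))).

Definition on_segment P Q X : Prop :=
  exists2 t : R, 0 <= t <= 1 & X = (1 - t) *: P + t *: Q.

Record triangle := Triangle {
  vA : 'rV[R]_2;
  vB : 'rV[R]_2;
  vC : 'rV[R]_2;
  triangle_nondegenerate : cross (vB - vA) (vC - vA) != 0 }.

(* l is the length of the segment joining A to the point of the side BC on the
   internal bisector of the angle at A. *)
Definition bisector_length A B C (l : R) : Prop :=
  exists D, [/\ on_segment B C D, angle B A D = angle D A C & edist A D = l].

Definition has_bisectors (t : triangle) (la lb lc : R) : Prop :=
  [/\ bisector_length (vA t) (vB t) (vC t) la,
      bisector_length (vB t) (vC t) (vA t) lb &
      bisector_length (vC t) (vA t) (vB t) lc].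

(* The point of contact T is required to lie on the segment PQ, not just on the
   line: this is what separates the incircle from the three excircles. *)
Definition tangent_to_segment I r P Q : Prop :=
  exists T, [/\ on_segment P Q T, dot (T - I) (Q - P) = 0 & edist I T = r].

Definition is_inradius (t : triangle) (r : R) : Prop :=
  0 < r /\
  exists I, [/\ tangent_to_segment I r (vB t) (vC t),
                tangent_to_segment I r (vC t) (vA t) &
                tangent_to_segment I r (vA t) (vB t)].

Definition area (t : triangle) : R :=
  `|cross (vB t - vA t) (vC t - vA t)| / 2.

Definition perimeter (t : triangle) : R :=
  edist (vB t) (vC t) + edist (vC t) (vA t) + edist (vA t) (vB t).

Definition is_area (t : triangle) (s : R) : Prop := s = area t.

Definition is_perimeter (t : triangle) (p : R) : Prop := p = perimeter t.

End EuclideanPlane.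

Inductive radical_formula : Type :=
  | FVarA | FVarB | FVarC
  | FConst of rat
  | FAdd of radical_formula & radical_formula
  | FSub of radical_formula & radical_formula
  | FMul of radical_formula & radical_formula
  | FDiv of radical_formula & radical_formula
  | FRoot (n : nat) of (2 <= n)%N & radical_formula.

(* [radical_value la lb lc f z]: for some choice of the complex roots occurring
   in f, made independently at each occurrence, no denominator of f vanishes and
   the value of f is z. *)
Inductive radical_value (R : realType) (la lb lc : R) :
    radical_formula -> R[i] -> Prop :=
  | ValVarA : radical_value la lb lc FVarA la%:C
  | ValVarB : radical_value la lb lc FVarB lb%:C
  | ValVarC : radical_value la lb lc FVarC lc%:C
  | ValConst (q : rat) : radical_value la lb lc (FConst q) (ratr q)
  | ValAdd f g (x y : R[i]) :
      radical_value la lb lc f x -> radical_value la lb lc g y ->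
      radical_value la lb lc (FAdd f g) (x + y)
  | ValSub f g (x y : R[i]) :
      radical_value la lb lc f x -> radical_value la lb lc g y ->
      radical_value la lb lc (FSub f g) (x - y)
  | ValMul f g (x y : R[i]) :
      radical_value la lb lc f x -> radical_value la lb lc g y ->
      radical_value la lb lc (FMul f g) (x * y)
  | ValDiv f g (x y : R[i]) :
      radical_value la lb lc f x -> radical_value la lb lc g y -> y != 0 ->
      radical_value la lb lc (FDiv f g) (x / y)
  | ValRoot n (n_ge2 : (2 <= n)%N) f (x z : R[i]) :
      radical_value la lb lc f x -> z ^+ n = x ->
      radical_value la lb lc (FRoot n_ge2 f) z.

(* A quantity attached to triangles is given by its graph Q. Since every triple
   of positive reals is the triple of bisector lengths of a triangle, a formula
   that expresses Q is defined at every such triple. *)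
Definition expresses (R : realType) (f : radical_formula)
    (Q : triangle R -> R -> Prop) : Prop :=
  forall la lb lc : R, 0 < la -> 0 < lb -> 0 < lc ->
  forall t : triangle R, has_bisectors t la lb lc ->
  forall q : R, Q t q -> radical_value la lb lc f q%:C.

(* Main.v *)
Require Import Defs.
From HB Require Import structures.
From mathcomp Require Import all_boot all_order all_algebra.
From mathcomp Require Import all_fingroup all_solvable all_field.
From mathcomp Require Import complex polyrcf boolp reals trigo.
From mathcomp Require classical_sets.
From mathcomp Require Import ring lra.

(** A single triangle defeats every formula: the one whose bisectors have
    lengths 2, 3 and 6.  All three arguments of a formula are then rational, so
    every value that a formula takes there is a number obtained from rational
    numbers by field operations and root extractions.

    Let [u], [v], [w] be the distances from the vertices to the contact points
    of the incircle, divided by the semiperimeter [p], and let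
    [rho = u * v * w], which is the square of [r / p].  A bisector satisfies
      [l ^ 2 * psi u = 4 * p ^ 2 * (1 - u) * (1 - v) * (1 - w)]  with
      [psi u = (1 - u) * (1 + u) ^ 2 / u],
    so that prescribing the bisectors prescribes the ratios of [psi u],
    [psi v], [psi w].  Since [u + v + w = 1], this is a system of equations in
    the elementary symmetric functions of [u], [v], [w].  In general it has
    degree 10, but 1/2 = 1/3 + 1/6: when one inverse bisector is the sum of the
    other two, two of the equations define a rational curve, which is
    parametrised by [y] with [y ^ 2 = 45 + 9 / rho], and the last equation
    becomes
      [y ^ 3 * (y ^ 2 - 3 * y - 36) ^ 3
         = 686 * (y - 6) * (y ^ 2 - 45) * (y ^ 2 - 72) ^ 2],
    of degree 9 ([nonic]).  The squares of the inradius, of the area and of the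
    perimeter are explicit rational functions of its root [y]
    ([triangle_2_3_6]).

    The nonic is not solvable.  It is irreducible modulo 13, and modulo 11 it is
    the product of an irreducible quintic and an irreducible quartic.  Frobenius
    automorphisms at these two primes ([frobenius_element]) make its Galois
    group transitive on the nine roots, of order divisible by 5.  Such a group
    is primitive, so its nontrivial normal subgroups are transitive, and none of
    these is abelian; hence every term of the derived series is transitive on
    the roots ([degree9_der_transitive], [nonic_der_transitive]).

    On the other side, in a Galois extension of the rationals containing all
    numbers that occur, a number computed by radicals is fixed by some term of
    the derived series: if [z ^ n] is fixed by one term, then two terms further
    [z] is fixed, because on [z] the automorphisms of the next term act by
    roots of unity which they fix, hence commute ([der_fixed_root]).

    Finally suppose that one of the three quantities, say [q], is given by
    radicals.  The relation [q ^ 2 * B(y) = A(y)] with rational polynomials [A]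
    and [B] of degree at most 8 is carried by a transitive group fixing [q] to
    all nine roots, so it is an identity between polynomials; but [B] vanishes
    at 6 and [A] does not ([nonic_not_solvable]). *)

Set Implicit Arguments.
Unset Strict Implicit.
Unset Printing Implicit Defensive.

Import Order.TTheory GRing.Theory Num.Theory.

(** * Transitive groups of degree 9 *)

Section SmallIndex.
Local Open Scope group_scope.

(** An element of prime order [p] permutes fewer than [p] cosets, so it fixes
    them all. *)
Lemma prime_order_small_index (gT : finGroupType) (G H : {group gT}) p (x : gT) :
  prime p -> H \subset G -> #|G : H| < p -> x \in G -> #[x] = p -> x \in H.
Proof.
move=> p_pr sHG iGH Gx ox.
have orb_le : #|orbit 'Rs <[x]> H| < p.
  apply: leq_ltn_trans iGH.
  rewrite subset_leq_card //; apply/subsetP => _ /orbitP[y xy <-].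
  by apply/rcosetsP; exists y; rewrite /= ?rcosetE //; apply: subsetP xy; rewrite cycle_subG.
have card1 : #|orbit 'Rs <[x]> (H : {set gT})| = 1%N.
  have := dvdn_orbit 'Rs <[x]> (H : {set gT}); rewrite -[#|<[x]>%G|]/#[x] ox.
  have [_ p_div] := primeP p_pr; move/p_div => /orP[/eqP // | /eqP eq_p].
  by rewrite eq_p ltnn in orb_le.
have : x \in 'C_<[x]>[(H : {set gT}) | 'Rs].
  have /eqP -> : 'C_<[x]>[(H : {set gT}) | 'Rs] == <[x]>; last exact: cycle_id.
  rewrite eqEcard subsetIl /= -(Lagrange (subsetIl <[x]> 'C[(H : {set gT}) | 'Rs])).
  by rewrite -card_orbit card1 muln1 leqnn.
rewrite inE cycle_id /= => /astab1P; rewrite /= rcosetE => Hx.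
by rewrite -Hx rcoset_refl.
Qed.

End SmallIndex.

Section Degree9.
Local Open Scope group_scope.
Variables (T : finType) (G : {group {perm T}}).
Hypotheses (cardT : #|T| = 9) (trG : [transitive G, on setT | 'P]).
Hypothesis (G5 : 5 %| #|G|).

(** Primitivity means that a point stabiliser is maximal.  A subgroup strictly
    in between would have index 3 twice, so both steps would keep every element
    of order 5: such an element would fix all points. *)
Lemma degree9_primitive : [primitive G, on setT | 'P].
Proof.
have /card_gt0P[x _] : 0 < #|T| by rewrite cardT.
rewrite (trans_prim_astab (in_setT x) trG).
have [p Gp op] := Cauchy (isT : prime 5) G5.
apply/maximal_eqP; split=> [|H sCH sHG]; first exact: subsetIl.
have iC : #|G : 'C_G[x | 'P]| = 9 by rewrite -card_orbit (atransP trG) ?inE ?cardsT.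
have := Lagrange_index sHG sCH; rewrite iC => eq9.
have: #|G : H| \in divisors 9 by rewrite -dvdn_divisors // -eq9 dvdn_mulr.
rewrite (_ : divisors 9 = [:: 1; 3; 9])%N // !inE => /or3P[] /eqP iGH.
- by right; apply/eqP; rewrite eqEsubset sHG -indexg_eq1 iGH.
- have iHC : #|H : 'C_G[x | 'P]| = 3.
    by apply/eqP; rewrite -(eqn_pmul2l (isT : 0 < 3)) -[3 in X in X == _]iGH eq9.
  have op1 : #[p] = 1%N; last by rewrite op1 in op.
  apply/eqP; rewrite order_eq1; apply/eqP/permP => y; rewrite perm1.
  have [g Gg ->] : exists2 g, g \in G & y = 'P%act x g.
    by apply: (atransP2 trG); rewrite inE.
  have Gpg : p ^ g^-1 \in G by rewrite groupJ ?groupV.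
  have opg : #[p ^ g^-1] = 5 by rewrite orderJ.
  have Hpg : p ^ g^-1 \in H.
    by apply: prime_order_small_index Gpg opg; rewrite ?iGH.
  have : p ^ g^-1 \in 'C_G[x | 'P].
    by apply: (prime_order_small_index _ sCH _ Hpg opg); rewrite ?iHC.
  rewrite inE => /andP[_ /astab1P /=]; rewrite /aperm conjgE invgK !permM.
  by move/(congr1 g); rewrite permKV.
- left; apply/eqP; rewrite eq_sym eqEsubset sCH -indexg_eq1.
  by rewrite -(eqn_pmul2l (isT : 0 < 9)) -[9 in X in X == _]iGH eq9.
Qed.

(** A transitive abelian group is regular, here of order 9.  An element [p] of
    order 5 normalises it and centralises a subgroup whose order divides 9 and
    is 9 modulo 5, that is, all of it; as [p] fixes one of the 9 points, it
    would then fix them all. *)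
Lemma abelian_normal_not_transitive (N : {group {perm T}}) :
  N <| G -> abelian N -> ~~ [transitive N, on setT | 'P].
Proof.
move=> nNG abN; apply/negP => trN.
have [p Gp op] := Cauchy (isT : prime 5) G5.
have p5 : 5.-group <[p]> by rewrite /pgroup -orderE op.
have fixT : #|'Fix_(setT | 'P)(<[p]>)| = 4 %[mod 5].
  rewrite -(pgroup_fix_mod p5 (S := setT)) ?cardsT ?cardT //.
  by apply/actsP => a _ y; rewrite !inE.
have /card_gt0P[x] : 0 < #|'Fix_(setT | 'P)(<[p]>)| by case: #|_| fixT.
rewrite inE => /andP[_ /afixP fixx].
have commN (a b : {perm T}) y : a \in N -> b \in N -> a (b y) = b (a y).
  by move=> Na Nb; rewrite -!permM; congr (fun_of_perm _ y); apply: (centsP abN).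
have stab1 : 'C_N[x | 'P] = 1.
  apply/trivgP/subsetP => a; rewrite inE => /andP[Na /astab1P /= fixa]; rewrite inE.
  apply/eqP/permP => y; rewrite perm1.
  have [b Nb ->] : exists2 b, b \in N & y = 'P%act x b.
    by apply: (atransP2 trN); rewrite inE.
  by rewrite /= /aperm commN //; congr (b _).
have cardN : #|N| = 9.
  by rewrite -(card_orbit_stab 'P N x) stab1 cards1 muln1 (atransP trN) ?cardsT ?inE.
have nNp : <[p]> \subset 'N(N).
  by rewrite cycle_subG; apply: subsetP Gp; apply: normal_norm.
have cNp : N \subset 'C(<[p]>).
  have := pgroup_fix_mod (to := 'J) (S := N) p5; rewrite astabsJ => /(_ nNp).
  have := cardSg (subsetIl N 'C(<[p]>)).
  rewrite afixJ cardN => /= cdvd cmod; apply/setIidPl/eqP.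
  rewrite eqEcard subsetIl cardN /=; move: cdvd cmod.
  rewrite dvdn_divisors // (_ : divisors 9 = [:: 1; 3; 9])%N // !inE.
  by case/or3P => /eqP ->.
have op1 : #[p] = 1%N; last by rewrite op1 in op.
apply/eqP; rewrite order_eq1; apply/eqP/permP => y; rewrite perm1.
have [b Nb ->] : exists2 b, b \in N & y = 'P%act x b.
  by apply: (atransP2 trN); rewrite inE.
rewrite /= /aperm -!permM.
have -> : b * p = p * b.
  exact: (centP (subsetP cNp b Nb) p (cycle_id p)).
by rewrite permM; congr (b _); apply: (fixx p); apply: cycle_id.
Qed.

Lemma degree9_der_transitive k : [transitive G^`(k), on setT | 'P].
Proof.
elim: k => [|k IHk]; first by rewrite derg0.
case: (prim_trans_norm degree9_primitive (der_normal k.+1 G)) => // cent.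
have derG1 : G^`(k.+1) = 1.
  apply/trivgP/subsetP => a /(subsetP cent); rewrite inE => /andP[_ /astabP fixa].
  by rewrite inE; apply/eqP/permP => y; rewrite perm1; apply: fixa; rewrite inE.
have abN : abelian G^`(k).
  by apply/derG1P; rewrite derg1 -dergSn.
by have := abelian_normal_not_transitive (der_normal k G) abN; rewrite IHk.
Qed.

End Degree9.

Local Open Scope ring_scope.
Local Open Scope complex_scope.

(** * Radicals and the derived series of a Galois group *)

Section GaloisRadicals.
Variables (F : fieldType) (L : splittingFieldType F).
Local Notation G := 'Gal({:L} / 1)%g.
Implicit Types (x z : L) (g h : gal_of {:L}) (k n : nat).

Lemma mem_galG g : g \in G.
Proof. by rewrite gal_kHom ?sub1v // k1AHom. Qed.

Lemma galMx g h x : (g * h)%g x = h (g x).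
Proof. by rewrite galM ?memvf. Qed.

Lemma galVKx g x : (g^-1)%g (g x) = x.
Proof. by rewrite -galMx mulgV gal_id. Qed.

(** Being fixed by a term of the derived series is the Galois-theoretic form of
    solvability of a single number: no tower of radical extensions is needed. *)
Definition der_fixed k x := forall g, g \in (G^`(k))%g -> g x = x.

Lemma der_antimono k m : (k <= m)%N -> (G^`(m) \subset G^`(k))%g.
Proof.
elim: m => [|m IHm]; first by rewrite leqn0 => /eqP ->.
rewrite leq_eqVlt => /orP[/eqP -> // | /IHm]; apply: subset_trans.
exact: der_subS.
Qed.

Lemma der_fixed_leq k m x : (k <= m)%N -> der_fixed k x -> der_fixed m x.
Proof. by move=> le_km fx g /(subsetP (der_antimono le_km))/fx. Qed.

Lemma der_fixed_alg k (a : F) : der_fixed k a%:A.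
Proof. by move=> g _; rewrite linearZ rmorph1. Qed.

Lemma der_fixed2 k m x y (f : L -> L -> L) :
  (forall g, g (f x y) = f (g x) (g y)) ->
  der_fixed k x -> der_fixed m y -> der_fixed (maxn k m) (f x y).
Proof.
move=> fg /(der_fixed_leq (leq_maxl k m)) fx /(der_fixed_leq (leq_maxr k m)) fy.
by move=> g Gg; rewrite fg fx ?fy.
Qed.

(** The commutator of [g] and [h] fixes [z] as soon as [g^-1] and [h^-1]
    commute on [z], and the automorphisms fixing [z] form a group. *)
Lemma commutator_fixed (H : {group gal_of {:L}}) z :
  (forall g h, g \in H -> h \in H -> g (h z) = h (g z)) ->
  forall g, g \in (H^`(1))%g -> g z = z.
Proof.
move=> commz; pose S := [set g : gal_of {:L} | g z == z].
have group_S : group_set S.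
  apply/group_setP; split=> [|g h]; first by rewrite inE gal_id.
  by rewrite !inE galMx => /eqP -> /eqP ->.
suffices /subsetP sHS: (H^`(1) \subset Group group_S)%g.
  by move=> g /sHS; rewrite inE => /eqP.
rewrite derg1 gen_subG; apply/subsetP => _ /imset2P[g h Hg Hh ->].
rewrite inE; have -> : [~ g, h]%g = (g^-1 * h^-1 * (h^-1 * g^-1)^-1)%g.
  by rewrite commgEl conjgE invMg !invgK !mulgA.
have comm_inv : (g^-1 * h^-1)%g z = (h^-1 * g^-1)%g z.
  by rewrite !galMx commz ?groupV.
by rewrite galMx comm_inv galVKx.
Qed.

(** Automorphisms map a root of unity to one of its powers. *)
Lemma unity_root_gal_comm n z g h :
  (0 < n)%N -> z ^+ n = 1 -> g (h z) = h (g z).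
Proof.
move=> n_gt0 zn1; have [m prim_z _] := prim_order_exists n_gt0 zn1.
have pow (f : gal_of {:L}) : exists i, f z = z ^+ i.
  have [|i ->] := prim_rootP prim_z (x := f z); last by exists i.
  by rewrite -rmorphXn (prim_expr_order prim_z) rmorph1.
have [[i gz] [j hz]] := (pow g, pow h).
by rewrite hz gz !rmorphXn /= gz hz -!exprM mulnC.
Qed.

Lemma der_fixed_unity n z : (0 < n)%N -> z ^+ n = 1 -> der_fixed 1 z.
Proof.
move=> n_gt0 zn1; apply: commutator_fixed => g h _ _.
exact: unity_root_gal_comm zn1.
Qed.

(** Kummer theory in one step: the automorphisms in the term [k.+1] fix both
    [x] and the roots of unity, so they multiply [z] by roots of unity that
    they all fix, and therefore commute on [z]. *)
Lemma der_fixed_root k n x z :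
  (0 < n)%N -> z ^+ n = x -> der_fixed k x -> der_fixed k.+2 z.
Proof.
move=> n_gt0 zn fx; apply: commutator_fixed => g h Gg Gh.
have [-> | nz] := eqVneq z 0; first by rewrite !rmorph0.
have zeta (f : gal_of {:L}) : f \in (G^`(k.+1))%g ->
  exists2 e, der_fixed 1 e & f z = e * z.
  move=> Gf; exists (f z / z); last by rewrite divfK.
  apply: (der_fixed_unity n_gt0); rewrite expr_div_n -rmorphXn /= zn.
  rewrite fx ?divff //; first by rewrite -zn expf_neq0.
  exact: subsetP (der_antimono (leqnSn k)) f Gf.
have in1 f : f \in (G^`(k.+1))%g -> f \in (G^`(1))%g.
  by apply: subsetP; apply: der_antimono.
have [[e1 fe1 gz] [e2 fe2 hz]] := (zeta g Gg, zeta h Gh).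
by rewrite hz gz !rmorphM /= hz gz fe1 ?fe2 ?in1 // mulrCA.
Qed.

End GaloisRadicals.

(** * Algebraic integers and Frobenius automorphisms *)

Section AlgebraicIntegers.
Variable L : splittingFieldType rat.
Local Notation alg_int := (integralOver (intr : int -> L)).
Local Notation G := 'Gal({:L} / 1)%g.

(** By Gauss's lemma, a monic integer polynomial with the rational root [r] is
    divisible in integer polynomials by a multiple of ['X - r], whose leading
    coefficient is then a unit. *)
Lemma alg_int_rat (r : rat) : alg_int r%:A -> exists m : int, r%:A = m%:~R :> L.
Proof.
case=> q mon_q rq.
have {rq} rq : root (map_poly intr q) r.
  move: rq; rewrite -(fmorph_root (in_alg L)) -map_poly_comp /=.
  by congr (is_true (root _ _)); apply: eq_map_poly => a; rewrite /= -in_algE rmorph_int.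
have := rq; rewrite -dvdp_XsubCl => /dvdpP_rat_int[q1 [a nz_a Dq1] [r1 Dq]].
have sz1 : size q1 = 2%N.
  by have := size_XsubC r; rewrite Dq1 size_scale // size_rat_int_poly.
have lead1 : lead_coef q1 \is a GRing.unit.
  apply/unitrP; exists (lead_coef r1).
  by rewrite mulrC -lead_coefM -Dq (monicP mon_q).
have c1 : 1 = a * (lead_coef q1)%:~R.
  have := congr1 lead_coef Dq1; rewrite lead_coefXsubC lead_coefZ.
  by rewrite lead_coef_map_inj //; apply: intr_inj.
have c0 : - r = a * (q1`_0)%:~R.
  by have := congr1 (fun f : {poly rat} => f`_0) Dq1; rewrite coefB coefX coefC coefZ coef_map sub0r.
have ll : (lead_coef q1)%:~R * (lead_coef q1)%:~R = 1 :> rat.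
  have : (lead_coef q1 == 1) || (lead_coef q1 == -1) := lead1.
  by case/orP=> /eqP ->; rewrite ?mulr1 // rmorphN mulrNN mulr1.
have Da : a = (lead_coef q1)%:~R by apply/esym; rewrite -[LHS]mul1r [X in X * _]c1 -mulrA ll mulr1.
exists (- (lead_coef q1 * q1`_0)).
suff -> : r = (- (lead_coef q1 * q1`_0))%:~R by rewrite -in_algE rmorph_int.
by rewrite rmorphN rmorphM /= -Da -c0 opprK.
Qed.

Lemma alg_int_nat n : alg_int n%:R. Proof. exact: integral_nat. Qed.

Lemma alg_int_gal (g : gal_of {:L}) x : alg_int x -> alg_int (g x).
Proof.
case=> q mon_q qx; exists q => //.
have := rmorph_root g qx; rewrite -map_poly_comp.
by congr (is_true (root _ _)); apply: eq_map_poly => a; rewrite /= rmorph_int.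
Qed.

(** Ideals of the ring of algebraic integers, as predicates on the field. *)
Definition ideal_over (p : nat) (I : L -> Prop) :=
  [/\ I p%:R, (forall x, I x -> alg_int x), (forall x y, I x -> I y -> I (x + y)),
      (forall a x, alg_int a -> I x -> I (a * x)) & ~ I 1].

Definition maximal_over p (M : L -> Prop) :=
  ideal_over p M /\ forall I, ideal_over p I -> (forall x, M x -> I x) -> forall x, I x -> M x.

(** Only properness needs an argument: the inverse of [p] would be a rational
    algebraic integer, hence an integer. *)
Lemma principal_ideal_over p : prime p ->
  ideal_over p (fun x => exists2 a, alg_int a & x = a * p%:R).
Proof.
move=> p_pr; split.
- by exists 1; rewrite ?mul1r //; apply: (alg_int_nat 1).
- by move=> _ [a Oa ->]; apply: integral_mul => //; apply: alg_int_nat.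
- move=> _ _ [a Oa ->] [b Ob ->]; exists (a + b); last by rewrite mulrDl.
  exact: integral_add.
- move=> a _ Oa [b Ob ->]; exists (a * b); last by rewrite mulrA.
  exact: integral_mul.
case=> a Oa a1; have nzp : p%:R != 0 :> rat by rewrite pnatr_eq0 -lt0n prime_gt0.
have Da : a = (p%:R^-1)%:A.
  have nzpL : p%:R != 0 :> L by rewrite -(rmorph_nat (in_alg L)) fmorph_eq0.
  apply: (mulIf nzpL); rewrite -a1 -(rmorph_nat (in_alg L)) -in_algE -rmorphM.
  by rewrite mulVf ?rmorph1.
have [m] := alg_int_rat (eq_ind _ _ Oa _ Da).
rewrite -Da => Dm; move: a1; rewrite Dm -[p%:R]/(p%:~R) -intrM.
rewrite -(rmorph_int (in_alg L)) -[1](rmorph1 (in_alg L)) => /fmorph_inj/eqP.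
rewrite eq_sym -[1]/(1%:~R) eqr_int => /eqP/(congr1 absz).
rewrite abszM => /eqP; rewrite muln_eq1 => /andP[_ /eqP p1].
by move: p_pr; rewrite [p]p1.
Qed.

Section Existence.
Import classical_sets.

Lemma maximal_over_exists p : prime p -> exists M, maximal_over p M.
Proof.
move=> p_pr; have P0 := principal_ideal_over p_pr.
(* The empty set is added because the empty chain has the empty set as union. *)
pose P (A : set L) := A = set0 \/ ideal_over p A.
have [F FP totF | M [PM maxM]] := @Zorn_bigcup L P.
  have [F0 | [A0 FA0 [x0 A0x0]]] : (forall A, F A -> A = set0) \/ exists2 A, F A & (A !=set0)%classic.
    have [?|/existsNP[A /not_implyP[FA /eqP/set0P A0]]] := pselect (forall A, F A -> A = set0); first by left.
    by right; exists A.
  - by left; rewrite eqEsubset; split=> // x [A FA]; rewrite (F0 _ FA).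
  right; have idA A x : F A -> A x -> ideal_over p A by move=> /FP[->|].
  split.
  - by exists A0 => //; have [] := idA _ _ FA0 A0x0.
  - by move=> x [A FA Ax]; have [_ sub _ _ _] := idA _ _ FA Ax; apply: sub.
  - move=> x y [A FA Ax] [B FB By].
    have [AB | BA] := totF _ _ FA FB.
      by exists B => //; have [_ _ add _ _] := idA _ _ FB By; apply: add => //; apply: AB.
    by exists A => //; have [_ _ add _ _] := idA _ _ FA Ax; apply: add => //; apply: BA.
  - move=> a x Oa [A FA Ax]; exists A => //.
    by have [_ _ _ mul _] := idA _ _ FA Ax; apply: mul.
  - by move=> [A FA A1]; have [_ _ _ _] := idA _ _ FA A1; apply.
have idM : ideal_over p M.
  case: PM => // M0; case: (maxM _ _ (or_intror P0)); rewrite M0; split=> // sub.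
  by apply: (sub p%:R); have [] := P0.
exists M; split=> // I idI MI x Ix; apply: contrapT => Mx.
by apply: (maxM I); [split=> // IM; apply: Mx; apply: IM | right].
Qed.

End Existence.

Section MaximalIdeal.
Variables (p : nat) (p_pr : prime p) (M : L -> Prop) (maxM : maximal_over p M).

Let Mp : M p%:R. Proof. by case: maxM => [[]]. Qed.
Lemma maximal_alg_int x : M x -> alg_int x. Proof. by case: maxM => [[]]; auto. Qed.
Lemma maximal_add x y : M x -> M y -> M (x + y). Proof. by case: maxM => [[]]; auto. Qed.
Lemma maximal_mul a x : alg_int a -> M x -> M (a * x). Proof. by case: maxM => [[]]; auto. Qed.
Lemma maximal_not1 : ~ M 1. Proof. by case: maxM => [[]]; auto. Qed.
Lemma maximal_opp x : M x -> M (- x).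
Proof. by move=> Mx; rewrite -mulN1r; apply: maximal_mul => //; apply/integral_opp/integral1. Qed.
Lemma maximal_sub x y : M x -> M y -> M (x - y).
Proof. by move=> Mx My; apply/maximal_add/maximal_opp. Qed.
Lemma maximal0 : M 0. Proof. by rewrite -[0](subrr p%:R); apply: maximal_sub. Qed.

Lemma maximal_inv x : alg_int x -> ~ M x -> exists2 a, alg_int a & M (1 - a * x).
Proof.
move=> Ox Mx; pose I y := exists2 a, alg_int a & M (y - a * x).
have MI y : M y -> I y.
  by move=> My; exists 0; [apply: integral0 | rewrite mul0r subr0].
apply: contrapT => noinv; apply: Mx.
have [idM max] := maxM; apply: (max I) => //; last first.
  by exists 1; [apply: integral1 | rewrite mul1r subrr; apply: maximal0].
split=> //; first exact: MI.
- move=> y [a Oa My]; rewrite -[y](subrK (a * x)).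
  by apply: integral_add; [apply: maximal_alg_int | apply: integral_mul].
- move=> y z [a Oa My] [b Ob Mz]; exists (a + b); first exact: integral_add.
  by rewrite mulrDl opprD addrACA; apply: maximal_add.
- move=> b y Ob [a Oa My]; exists (b * a); first exact: integral_mul.
  by rewrite -mulrA -mulrBr; apply: maximal_mul.
Qed.

Lemma maximal_prime x y : alg_int x -> alg_int y -> M (x * y) -> M x \/ M y.
Proof.
move=> Ox Oy Mxy; have [?|Mx] := pselect (M x); [by left | right].
have [a Oa Ma] := maximal_inv Ox Mx.
rewrite -[y](subrK (a * x * y)) -{1}[y]mul1r -mulrBl -mulrA.
by apply: maximal_add; [rewrite mulrC|]; apply: maximal_mul.
Qed.

Lemma maximal_prod (I : Type) (r : seq I) (P : pred I) (E : I -> L) :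
  (forall i, P i -> alg_int (E i)) -> M (\prod_(i <- r | P i) E i) ->
  exists2 i, P i & M (E i).
Proof.
move=> OE; elim: r => [|i r IHr]; first by rewrite big_nil => /maximal_not1.
rewrite big_cons; case: ifP => // Pi /maximal_prime[]; auto; last by exists i.
by elim/big_ind: _ => //; [apply: integral1 | move=> *; apply: integral_mul].
Qed.

Definition congM x y := M (x - y).

Lemma congM_refl x : congM x x.
Proof. by rewrite /congM subrr; apply: maximal0. Qed.

Lemma congM_sym x y : congM x y -> congM y x.
Proof. by move=> /maximal_opp; rewrite opprB. Qed.

Lemma congM_trans y x z : congM x y -> congM y z -> congM x z.
Proof. by move=> xy /(maximal_add xy); rewrite /congM addrA subrK. Qed.

Lemma congM_add x y z t : congM x y -> congM z t -> congM (x + z) (y + t).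
Proof. by move=> xy /(maximal_add xy); rewrite /congM opprD addrACA. Qed.

Lemma congM_mul x y z t : alg_int y -> alg_int z ->
  congM x y -> congM z t -> congM (x * z) (y * t).
Proof.
move=> Oy Oz xy zt; rewrite /congM; have -> : x * z - y * t = z * (x - y) + y * (z - t).
  by rewrite !mulrBr addrA [z * y]mulrC subrK [x * z]mulrC.
by apply: maximal_add; apply: maximal_mul.
Qed.

Lemma alg_int_exp x n : alg_int x -> alg_int (x ^+ n).
Proof.
move=> Ox; elim: n => [|n IHn]; first exact: integral1.
by rewrite exprS; apply: integral_mul.
Qed.

Lemma congM_exp n x y : alg_int x -> alg_int y -> congM x y -> congM (x ^+ n) (y ^+ n).
Proof.
move=> Ox Oy xy; elim: n => [|n IHn]; first exact: congM_refl.
by rewrite !exprS; apply: congM_mul => //; apply: alg_int_exp.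
Qed.

Lemma maximal_exp n x : alg_int x -> M (x ^+ n) -> M x.
Proof.
move=> Ox; elim: n => [|n IHn]; first by move/maximal_not1.
by rewrite exprS => /maximal_prime[] //; apply: alg_int_exp.
Qed.

(** The inner binomial coefficients are divisible by [p], which lies in [M]. *)
Lemma frobeniusD x y : alg_int x -> alg_int y ->
  congM ((x + y) ^+ p) (x ^+ p + y ^+ p).
Proof.
move=> Ox Oy; rewrite exprDn -(prednK (prime_gt0 p_pr)).
rewrite big_ord_recr big_ord_recl /= subn0 subnn bin0 binn !mulr1n mulr1 mul1r.
rewrite -addrA addrCA /congM addrK.
elim/big_ind: _ => [||i _]; [exact: maximal0 | exact: maximal_add |].
rewrite -mulr_natl prednK ?prime_gt0 //.
have /dvdnP[m ->] : (p %| 'C(p, bump 0 i))%N.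
  apply: prime_dvd_bin => //; rewrite /bump /= add1n.
  by rewrite -{2}(prednK (prime_gt0 p_pr)) ltnS.
rewrite natrM -mulrA mulrCA mulrC; apply: maximal_mul => //.
apply: integral_mul; [exact: alg_int_nat | by apply: integral_mul; apply: alg_int_exp].
Qed.

Lemma alg_int_int (c : int) : alg_int c%:~R.
Proof. exact: (integral_id (intr : int -> L) c). Qed.

Lemma frobenius_int (c : int) : congM (c%:~R ^+ p) c%:~R.
Proof.
have Mint (d : int) : M (d * p)%:~R by rewrite intrM; apply: maximal_mul; [apply: alg_int_int | apply: Mp].
have nat_case n : congM (n%:R ^+ p) n%:R.
  elim: n => [|n IHn]; first by rewrite expr0n (gtn_eqF (prime_gt0 p_pr)); apply: congM_refl.
  rewrite -natr1; apply: congM_trans (frobeniusD _ _) _; try exact: alg_int_nat.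
    exact: (alg_int_nat 1).
  by rewrite expr1n; apply/congM_add/congM_refl.
rewrite (divz_eq c p); set r := (c %% p)%Z.
have [n ->] : exists n : nat, r = n by exists `|r|%N; rewrite gez0_abs // modz_ge0 // -lt0n prime_gt0.
have cn : congM ((c %/ p)%Z * p + n)%:~R n%:R by rewrite /congM intrD addrK.
apply: congM_trans (congM_exp _ _ _ cn) _.
- exact: alg_int_int.
- exact: alg_int_nat.
by apply: congM_trans (nat_case n) _; apply: congM_sym.
Qed.

Lemma alg_int_horner (q : {poly int}) x : alg_int x -> alg_int (map_poly intr q).[x].
Proof.
move=> Ox; apply: integral_horner => //; apply/integral_poly => i.
by rewrite coef_map; apply: alg_int_int.
Qed.

Lemma frobenius_horner (q : {poly int}) x : alg_int x ->
  congM ((map_poly intr q).[x] ^+ p) (map_poly intr q).[x ^+ p].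
Proof.
move=> Ox; elim/poly_ind: q => [|q c IHq].
  by rewrite rmorph0 !horner0 expr0n (gtn_eqF (prime_gt0 p_pr)); apply: congM_refl.
rewrite rmorphD rmorphM /= map_polyX map_polyC !hornerMXaddC.
apply: congM_trans (frobeniusD _ _) _.
- by apply: integral_mul => //; apply: alg_int_horner.
- exact: alg_int_int.
apply: congM_add (frobenius_int _); rewrite exprMn; apply: congM_mul => //.
- by apply: alg_int_horner; apply: alg_int_exp.
- exact: alg_int_exp.
- exact: congM_refl.
Qed.

(** The decomposition group of [M]. *)
Definition stabM (g : gal_of {:L}) := forall x, M (g x) -> M x.

(** The inverse of [g] is one of its powers. *)
Lemma stabM_inv g x : stabM g -> M x -> M (g x).
Proof.
move=> stab Mx; have : M ((g ^+ #[g].-1)%g (g x)).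
  by rewrite -galMx -expgS prednK ?order_gt0 // expg_order gal_id.
elim: (_.-1) => [|n IHn]; first by rewrite expg0 gal_id.
by rewrite expgSr galMx => /stab.
Qed.

Lemma fixed_by_gal x : (forall g : gal_of {:L}, g x = x) -> exists r : rat, x = r%:A.
Proof.
have galL : galois 1 {:L}.
  rewrite /galois sub1v normalFieldf andbT; apply/separableP => y _.
  by apply: pcharf0_separable => q; rewrite -(pchar_num rat q) (fmorph_pchar (in_alg L)).
move=> fix_x; apply/vlineP; rewrite -(galois_fixedField galL).
by apply/fixedFieldP; rewrite ?memvf.
Qed.

(** The coefficients are algebraic integers fixed by the Galois group, so they
    are integers. *)
Lemma conj_poly_int x : alg_int x ->
  exists q : {poly int}, map_poly intr q = \prod_(g : gal_of {:L}) ('X - (g x)%:P).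
Proof.
move=> Ox; pose P := \prod_(g : gal_of {:L}) ('X - (g x)%:P); rewrite -/P.
have OP i : alg_int P`_i.
  rewrite /P; elim/big_ind: _ i => [i|u v Ou Ov i|g _ i].
  - by rewrite coef1; apply: alg_int_nat.
  - rewrite coefM; elim/big_ind: _ => [||j _]; first exact: integral0.
      exact: integral_add.
    exact: integral_mul.
  - rewrite coefB coefX coefC; apply: integral_sub; first exact: alg_int_nat.
    by case: eqP => _; [apply: alg_int_gal | apply: integral0].
have PE (h : gal_of {:L}) : map_poly h P = P.
  rewrite /P rmorph_prod /= [RHS](reindex_inj (mulIg h)).
  by apply: eq_bigr => g _; rewrite rmorphB /= map_polyX map_polyC /= galMx.
have coefZ i : exists m : int, P`_i = m%:~R.
  have [r Dr] : exists r : rat, P`_i = r%:A.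
    by apply: fixed_by_gal => g; rewrite -coef_map PE.
  by rewrite Dr; apply: alg_int_rat; rewrite -Dr; apply: OP.
have [c Dc] := choice coefZ.
exists (\poly_(i < size P) c i); apply/polyP => i.
rewrite coef_map coef_poly; case: ltnP => [_ | le_i]; first exact/esym/Dc.
by rewrite nth_default.
Qed.

(** By the Chinese remainder theorem there is an algebraic integer [z] congruent
    to [x] modulo [M] and lying in all other conjugates of [M].  The polynomial
    whose roots are the conjugates of [z] has integer coefficients, so it takes
    a value in [M] at [z ^+ p]: some [g] satisfies [g z = z ^+ p] modulo [M].
    This [g] stabilises [M], since otherwise [g z], and with it [x], would be in
    [M], a case where the identity serves. *)
Lemma frobenius_element x : alg_int x ->
  exists2 g : gal_of {:L}, stabM g & congM (g x) (x ^+ p).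
Proof.
move=> Ox; have [Mx | Mx] := pselect (M x).
  exists 1%g => [y|]; first by rewrite gal_id.
  rewrite gal_id /congM; apply: maximal_sub => //.
  by rewrite -(prednK (prime_gt0 p_pr)) exprSr; apply: maximal_mul => //; apply: alg_int_exp.
(* For [g] outside the decomposition group, [y g] separates [M] from its preimage by [g]. *)
have /choice[y Dy] (g : gal_of {:L}) : exists y, ~ stabM g -> [/\ alg_int y, M (g y) & ~ M y].
  have [?|nstab] := pselect (stabM g); first by exists 0.
  have /existsNP[y /not_implyP[Mgy My]] : ~ (forall y, M (g y) -> M y) := nstab.
  exists y => _; split=> //.
  have := maximal_alg_int Mgy => /(alg_int_gal (g^-1)%g).
  by rewrite galVKx.
pose Y := \prod_(g : gal_of {:L} | ~~ `[< stabM g >]) y g.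
have OY g : ~~ `[< stabM g >] -> alg_int (y g).
  by move=> /asboolPn/Dy[].
have MY : ~ M Y.
  by case/(maximal_prod OY) => g /asboolPn/Dy[_ _ nMy] /nMy.
have OYY : alg_int Y.
  by rewrite /Y; elim/big_ind: _ => //; [apply: integral1 | move=> *; apply: integral_mul].
have [a Oa Ma] := maximal_inv OYY MY.
pose z := x * (a * Y).
have Oz : alg_int z by do 2?apply: integral_mul.
have xz : congM x z.
  by rewrite /congM /z -{1}[x]mulr1 -mulrBr; apply: maximal_mul.
have zg g : ~ stabM g -> M (g z).
  move=> nstab; have nst : ~~ `[< stabM g >] by apply/asboolPn.
  rewrite /z /Y (bigD1 g) //= mulrA mulrCA rmorphM mulrC; apply: maximal_mul.
    apply: alg_int_gal; apply: integral_mul; first exact: integral_mul.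
    elim/big_ind: _ => [||h /andP[/OY //]]; first exact: integral1.
    by move=> *; apply: integral_mul.
  by have [] := Dy _ nstab.
have [q Dq] := conj_poly_int Oz.
have q0 : (map_poly intr q).[z] = 0.
  rewrite Dq (bigD1 1%g) //= hornerM gal_id hornerXsubC subrr mul0r //.
have := frobenius_horner q Oz; rewrite q0 expr0n (gtn_eqF (prime_gt0 p_pr)).
move/congM_sym; rewrite /congM subr0 Dq horner_prod.
case/maximal_prod => [g _ | g _]; rewrite hornerXsubC.
  by apply: integral_sub; [apply: alg_int_exp | apply: alg_int_gal].
move=> Mzg; have stab : stabM g.
  apply: contrapT => /zg Mgz; apply: Mx.
  rewrite -[x](subrK z); apply: maximal_add => //.
  by apply: (maximal_exp (n := p)) => //; rewrite -[_ ^+ _](subrK (g z)); apply: maximal_add.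
exists g => //; apply: (congM_trans (y := g z)).
  by rewrite /congM -rmorphB; apply: stabM_inv.
apply: congM_trans (congM_sym Mzg) _.
by apply: congM_exp => //; apply: congM_sym.
Qed.

Lemma frobenius_iter g x n : alg_int x -> stabM g -> congM (g x) (x ^+ p) ->
  congM ((g ^+ n)%g x) (x ^+ (p ^ n)).
Proof.
move=> Ox stab gx; elim: n => [|n IHn].
  by rewrite expg0 gal_id expn0 expr1; apply: congM_refl.
rewrite expgSr galMx; apply: (congM_trans (y := g (x ^+ (p ^ n)))).
  by rewrite /congM -rmorphB; apply: stabM_inv.
rewrite rmorphXn /= expnS exprM; apply: congM_exp => //.
  exact: alg_int_gal.
exact: alg_int_exp.
Qed.

End MaximalIdeal.

End AlgebraicIntegers.

(** * Number fields inside a closed field *)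

Section NumberField.
Variable C : numClosedFieldType.
Local Notation QtoC := (ratr : rat -> C).
Local Notation pQtoC := (map_poly QtoC).

(** The last property says that [w] is a sum of elements of [s]; it makes every
    field that contains [s] contain [w]. *)
Lemma primitive_element (s : seq C) : (forall z, z \in s -> algebraicOver QtoC z) ->
  exists w, [/\ algebraicOver QtoC w,
    forall z, z \in s -> exists p, z = (pQtoC p).[w] &
    forall S : C -> Prop, S 0 -> (forall x y, S x -> S y -> S (x + y)) ->
      (forall z, z \in s -> S z) -> S w].
Proof.
elim: s => [|x s IHs] alg_s.
  by exists 0; split=> //; exact: algebraic0.
have in_xs z : z \in s -> z \in x :: s by rewrite inE orbC => ->.
have [z [alg_z Dz Sz]] := IHs (fun z sz => alg_s z (in_xs z sz)).
have [rx nz_rx rx0] := alg_s x (mem_head x s).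
have [rz nz_rz rz0] := algebraic_opp alg_z.
have pchar0_Q: [pchar rat] =i pred0 by apply: pchar_num.
have [n [[pz Dpz] [px Dpx]]] := pchar0_PET nz_rz rz0 nz_rx rx0 pchar0_Q.
rewrite opprK in Dpz Dpx; exists (x *+ n + z); split.
- apply: algebraic_add => //; rewrite -mulr_natr.
  apply: algebraic_mul; first exact: alg_s (mem_head x s).
  by rewrite -(rmorph_nat (ratr : {rmorphism rat -> C})); apply: algebraic_id.
- move=> y; rewrite inE => /predU1P[-> | /Dz[py ->]]; first by exists px.
  exists (py \Po (- pz)); rewrite map_comp_poly horner_comp rmorphN hornerN /= Dpz.
  by rewrite opprK.
move=> S S0 SD Ss; apply: (SD); last by apply: (Sz S) => // y sy; apply/Ss/in_xs.
elim: n {Dpz Dpx} => [|n IHn] //; rewrite mulrS; apply: SD => //.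
by apply: Ss; apply: mem_head.
Qed.

Lemma minimal_poly_exists w : algebraicOver QtoC w ->
  exists2 p : {poly rat}, p != 0 /\ root (pQtoC p) w &
    forall q, root (pQtoC q) w -> q != 0 -> (size p <= size q)%N.
Proof.
case=> p; have [n] := ubnP (size p); elim: n p => // n IHn p.
rewrite ltnS => le_pn nz_p pw.
have [[q [qw nz_q lt_qp]] | nq] := pselect (exists q, [/\ root (pQtoC q) w, q != 0 & (size q < size p)%N]).
  by apply: (IHn q) => //; apply: leq_trans le_pn.
exists p => // q qw nz_q; rewrite leqNgt; apply/negP => lt_qp.
by apply: nq; exists q.
Qed.

(** The extension is generated by a primitive element of the roots of a product
    of polynomials vanishing at the elements of [s]; so it is the splitting
    field of that product. *)
Lemma number_field_exists (s : seq C) : (forall z, z \in s -> algebraicOver QtoC z) ->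
  exists (L : splittingFieldType rat) (iota : {rmorphism L -> C}),
    forall z, z \in s -> exists x, iota x = z.
Proof.
move=> alg_s.
have [P nzP Ps] : exists2 P : {poly rat}, P != 0 & forall z, z \in s -> root (pQtoC P) z.
  elim: s alg_s => [|x s IHs] alg_s; first by exists 1; rewrite ?oner_eq0.
  have in_xs z : z \in s -> z \in x :: s by rewrite inE orbC => ->.
  have [P nzP Ps] := IHs (fun z sz => alg_s z (in_xs z sz)).
  have [q nzq qx] := alg_s x (mem_head x s).
  exists (q * P); first exact: mulf_neq0.
  move=> z; rewrite rmorphM rootM inE => /predU1P[-> | /Ps ->]; last exact: orbT.
  by rewrite qx.
have [r Dr] := closed_field_poly_normal (pQtoC P).
have nz_lead : lead_coef (pQtoC P) != 0 by rewrite lead_coef_eq0 map_poly_eq0.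
have rP z : (z \in r) = root (pQtoC P) z by rewrite Dr rootZ // root_prod_XsubC.
have alg_r z : z \in r -> algebraicOver QtoC z by rewrite rP => Pz; exists P.
have [w [alg_w Dw Sw]] := primitive_element alg_r.
have [m [nz_m mw] min_m] := minimal_poly_exists alg_w.
have irr_m : irreducible_poly m by apply/(subfx_irreducibleP mw nz_m).
pose L0 : fieldExtType rat := SubFieldExtType mw irr_m.
pose iota : {rmorphism L0 -> C} := @subfx_inj _ _ (ratr : {rmorphism rat -> C}) w m.
pose w0 : L0 := subfx_root _ w m.
have iw0 : iota w0 = w := subfx_inj_root mw nz_m.
have iotaQ (a : rat) : iota a%:A = ratr a by rewrite -in_algE -[LHS]/((iota \o in_alg L0) a) fmorph_eq_rat.
have iota_poly p : map_poly iota (map_poly (in_alg L0) p) = pQtoC p.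
  by rewrite -map_poly_comp; apply: eq_map_poly => a /=; apply: iotaQ.
have im z : z \in r -> exists x, iota x = z.
  move=> /Dw[p ->]; exists (map_poly (in_alg L0) p).[w0].
  by rewrite -horner_map iota_poly /= iw0.
have [r0 Dr0] : exists r0, map iota r0 = r.
  elim: (r) im => [|z r1 IHr] im1; first by exists [::].
  have [x Dx] := im1 z (mem_head z r1).
  have [|r0 Dr0] := IHr; first by move=> y r1y; apply: im1; rewrite inE r1y orbT.
  by exists (x :: r0); rewrite /= Dx Dr0.
have splitL0 : splitting_field_axiom L0.
  exists (map_poly (in_alg L0) P); first exact: alg_polyOver.
  exists r0.
    have prodE : map_poly iota (\prod_(x <- r0) ('X - x%:P)) = \prod_(z <- r) ('X - z%:P).
      rewrite rmorph_prod -Dr0 big_map; apply: eq_bigr => x _.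
      by rewrite rmorphB /= map_polyX map_polyC.
    by rewrite -(eqp_map iota) iota_poly prodE {1}Dr; apply: eqp_scale.
  have w0K : w0 \in <<1 & r0>>%VS.
    have [x Kx ix] : exists2 x, x \in <<1 & r0>>%VS & iota x = w.
      apply: (Sw (fun z => exists2 x, x \in <<1 & r0>>%VS & iota x = z)).
      - by exists 0; rewrite ?mem0v ?rmorph0.
      - move=> _ _ [x Kx <-] [y Ky <-]; exists (x + y); first exact: memvD.
        by rewrite rmorphD.
      move=> z; rewrite -Dr0 => /mapP[x r0x ->]; exists x => //.
      exact: seqv_sub_adjoin.
    by rewrite -(fmorph_inj iota (etrans ix (esym iw0))).
  apply/vspaceP => x; rewrite memvf; have [p ->] := subfxEroot mw nz_m x.
  exact: (rpred_horner (alg_polyOver <<1 & r0>>%AS p) w0K).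
pose L : splittingFieldType rat :=
  HB.pack (GRing.Field.sort L0) L0 (FieldExt_isSplittingField.Build rat L0 splitL0).
exists L, iota => z sz; apply: im.
by rewrite rP; apply: Ps.
Qed.

End NumberField.

(** * Factorisation modulo a maximal ideal *)

Section ResidueRoots.
Variable L : splittingFieldType rat.
Local Notation alg_int := (integralOver (intr : int -> L)).

(** Descending induction on the coefficients of [w]: the leading coefficient 1
    of [h] brings out [w`_j], up to multiples of higher coefficients.  It is
    used for [J] an ideal and for [J] the ring of algebraic integers. *)
Lemma monic_mul_cancel (J : L -> Prop) (h w : {poly L}) :
  J 0 -> (forall x y, J x -> J y -> J (x - y)) ->
  (forall a x, alg_int a -> J x -> J (a * x)) ->
  h \is monic -> (forall i, alg_int h`_i) ->
  (forall i, ((size h).-1 <= i)%N -> J (h * w)`_i) -> forall j, J w`_j.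
Proof.
move=> J0 JB JM mon_h Oh Jhw.
have JN x : J x -> J (- x) by move=> Jx; rewrite -sub0r; apply: (JB).
suff top n j : (size w <= j + n)%N -> J w`_j.
  by move=> j; apply: (top (size w)); apply: leq_addl.
elim: n j => [|n IHn] j szw; first by rewrite nth_default // -(addn0 j).
have [d sz_h] : exists d, size h = d.+1.
  by exists (size h).-1; rewrite prednK // size_poly_gt0 monic_neq0.
have := Jhw (j + d)%N; rewrite sz_h leq_addl coefM => /(_ isT).
have lt_d : (d < (j + d).+1)%N by rewrite ltnS leq_addl.
rewrite (bigD1 (Ordinal lt_d)) //= addnK.
have -> : h`_d = 1 by have := monicP mon_h; rewrite lead_coefE sz_h.
rewrite mul1r => Jsum; set S := (\sum_(i < _ | _) _) in Jsum.
rewrite -[w`_j](addrK S); apply: (JB) => //.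
rewrite /S; elim/big_ind: _ => [//|x y Jx Jy|i ne_id].
  by rewrite -[y]opprK; apply: (JB) => //; apply: JN.
have [le_id | lt_di] := leqP i d.
  apply: (JM) => //; apply: IHn.
  have lt_id : (i < d)%N by rewrite ltn_neqAle le_id andbT.
  apply: leq_trans szw _; rewrite addnS -addSn leq_add2r.
  by rewrite -addnBA // -addn1 leq_add2l subn_gt0.
by rewrite [h`_i]nth_default ?mul0r // sz_h.
Qed.

Variables (p : nat) (p_pr : prime p) (M : L -> Prop) (maxM : maximal_over p M).

Lemma maximal_horner (q : {poly L}) x :
  (forall i, M q`_i) -> alg_int x -> M q.[x].
Proof.
move=> Mq Ox; rewrite horner_coef; elim/big_ind: _ => [||i _].
- exact: maximal0 maxM.
- exact: maximal_add maxM.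
by rewrite mulrC; apply: (maximal_mul maxM) => //; apply: alg_int_exp.
Qed.

Lemma maximal_coefM (u v : {poly L}) :
  (forall i, alg_int u`_i) -> (forall i, M v`_i) -> forall i, M (u * v)`_i.
Proof.
move=> Ou Mv i; rewrite coefM; elim/big_ind: _ => [||j _].
- exact: maximal0 maxM.
- exact: maximal_add maxM.
exact: maximal_mul maxM _ _ _ _.
Qed.

Lemma alg_int_coefXsubC x i : alg_int x -> alg_int ('X - x%:P)`_i.
Proof.
move=> Ox; rewrite coefB coefX coefC; apply: integral_sub; first exact: alg_int_nat.
by case: eqP => // _; apply: integral0.
Qed.

(** Over the residue field of [M] the polynomial [h] divides a product of linear
    factors, so one of them belongs to [h].  If the first root [x] is not a root
    of [h], then it is one of [g], and ['X - x] is cancelled on both sides;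
    when no factor is left, [h] divides 1, which its degree forbids. *)
Lemma factor_root_mod (rs : seq L) (h g : {poly L}) :
  (forall x, x \in rs -> alg_int x) -> h \is monic -> (1 < size h)%N ->
  (forall i, alg_int h`_i) -> (forall i, alg_int g`_i) ->
  (forall i, M (\prod_(x <- rs) ('X - x%:P) - h * g)`_i) ->
  exists2 x, x \in rs & M h.[x].
Proof.
move=> + mon_h sz_h Oh; elim: rs g => [|x rs IHrs] g Ors Og Mhg.
  have Mg : forall j, M g`_j.
    apply: (monic_mul_cancel (h := h)) => //.
    - exact: maximal0 maxM.
    - exact: maximal_sub maxM.
    - exact: maximal_mul maxM.
    move=> i le_hi; have := maximal_opp maxM (Mhg i).
    rewrite big_nil coefB coef1 opprB; case: i le_hi => [|i _]; last by rewrite subr0.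
    by case: (size h) sz_h => [|[]].
  have := maximal_add maxM (Mhg 0%N) (maximal_coefM Oh Mg 0%N).
  by rewrite big_nil coefB subrK coef1 => /(maximal_not1 maxM).
have Ox : alg_int x by apply: (Ors); apply: mem_head.
have Ors1 y : y \in rs -> alg_int y by move=> rs_y; apply: (Ors); rewrite inE rs_y orbT.
have Ohx : alg_int h.[x] by apply: integral_horner => //; apply/integral_poly.
have Ogx : alg_int g.[x] by apply: integral_horner => //; apply/integral_poly.
have Mhgx : M (h.[x] * g.[x]).
  have := maximal_opp maxM (maximal_horner Mhg Ox).
  by rewrite big_cons hornerD hornerN !hornerM hornerXsubC subrr mul0r sub0r opprK.
have [Mhx | Mgx] := maximal_prime maxM Ohx Ogx Mhgx.
  by exists x => //; apply: mem_head.
have /factor_theorem[g1 Dg] : root (g - g.[x]%:P) x by rewrite rootE !hornerE subrr.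
have Og1 : forall i, alg_int g1`_i.
  apply: (monic_mul_cancel (h := 'X - x%:P)) => //.
  - exact: integral0.
  - exact: integral_sub.
  - exact: integral_mul.
  - exact: monicXsubC.
  - by move=> i; apply: alg_int_coefXsubC.
  move=> i _; have -> : ('X - x%:P) * g1 = g - g.[x]%:P by rewrite Dg mulrC.
  rewrite coefB coefC; apply: integral_sub => //.
  by case: eqP => // _; apply: integral0.
have [||y rs_y My] := IHrs g1 _ Og1 _ => //; last by exists y; rewrite // inE rs_y orbT.
apply: (monic_mul_cancel (h := 'X - x%:P)) => //.
- exact: maximal0 maxM.
- exact: maximal_sub maxM.
- exact: maximal_mul maxM.
- exact: monicXsubC.
- by move=> i; apply: alg_int_coefXsubC.
move=> i _.
have -> : ('X - x%:P) * (\prod_(y <- rs) ('X - y%:P) - h * g1) =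
   (\prod_(y <- x :: rs) ('X - y%:P) - h * g) + h * (g.[x])%:P.
  by rewrite big_cons mulrBr mulrCA [_ * g1]mulrC -Dg; ring.
rewrite coefD; apply: (maximal_add maxM (Mhg i)); apply: (maximal_coefM Oh) => j.
by rewrite coefC; case: eqP => // _; apply: maximal0 maxM.
Qed.

End ResidueRoots.

(** * Arithmetic of residues modulo a prime and a polynomial *)

(** Residue polynomials are lists of coefficients, lowest degree first. *)
Definition mpeval (R : comNzRingType) (x : R) (s : seq nat) : R :=
  foldr (fun a v => a%:R + x * v) 0 s.

Lemma rmorph_mpeval (R S : comNzRingType) (f : {rmorphism R -> S}) x s :
  f (mpeval x s) = mpeval (f x) s.
Proof. by elim: s => [|a s IHs] /=; rewrite ?rmorph0 // rmorphD rmorphM rmorph_nat IHs. Qed.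

Lemma mpeval_polyX (R : comNzRingType) (s : seq nat) :
  mpeval 'X s = Poly [seq a%:R | a <- s] :> {poly R}.
Proof.
elim: s => //= a s ->; rewrite cons_poly_def addrC mulrC.
by rewrite -(rmorph_nat (polyC : {rmorphism R -> {poly R}})).
Qed.

(** In what follows [red] represents the power [x ^+ size red] as a combination
    of lower powers of [x], modulo [p]: it encodes a monic polynomial modulo
    which one computes. *)
Section ModularPolynomials.
Variables (p : nat) (red : seq nat).
Implicit Types s t : seq nat.

Fixpoint mpadd s t :=
  match s, t with
  | [::], _ => t
  | _, [::] => s
  | a :: s', b :: t' => ((a + b) %% p)%N :: mpadd s' t'
  end.
Definition mpscale a s := [seq ((a * b) %% p)%N | b <- s].
Definition mpsub s t := mpadd s (mpscale p.-1 t).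
Definition mpmulX s :=
  mpadd (take (size red) (0%N :: s)) (mpscale (nth 0%N (0%N :: s) (size red)) red).
Definition mpmul s t := foldr (fun a u => mpadd (mpscale a t) (mpmulX u)) [::] s.
Definition mpexp s n := iter n (mpmul s) [:: 1%N].

(** The residue of [x ^+ (p ^ n)], by [n] successive [p]-th powers. *)
Definition mpfrobenius n := iter n (fun s => mpexp s p) [:: 0%N; 1%N].

(** The orbit of [x] under the Frobenius map has length exactly [d]: its [d]-th
    iterate is [x], and for [0 < n < d] the list [nth [::] inv n] is an inverse
    of the difference between the [n]-th iterate and [x]. *)
Definition mpX_order d (inv : seq (seq nat)) :=
  [&& size red == d, (1 < d)%N, all (fun n => n == 0%N) (mpsub (mpfrobenius d) [:: 0%N; 1%N]) &
   all (fun n => all (fun m => m == 0%N)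
       (mpsub (mpmul (nth [::] inv n) (mpsub (mpfrobenius n) [:: 0%N; 1%N])) [:: 1%N]))
     (iota 1 d.-1)].

Variables (L : splittingFieldType rat) (p_pr : prime p) (M : L -> Prop).
Hypothesis (maxM : maximal_over p M).
Variable (x : L).
Hypothesis Ox : integralOver (intr : int -> L) x.

Local Notation ev := (mpeval x).
Hypothesis redP : congM M (x ^+ size red) (ev red).
Local Notation alg_int := (integralOver (intr : int -> L)).
Local Notation cong := (congM M).

Lemma mpeval_int s : alg_int (ev s).
Proof.
elim: s => [|a s IHs] /=; first exact: integral0.
by apply: integral_add; [apply: alg_int_nat | apply: integral_mul].
Qed.

Lemma cong_mod n : cong (n %% p)%N%:R n%:R.
Proof.
apply: (congM_sym maxM); rewrite /congM {1}(divn_eq n p) natrD addrK natrM.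
by apply: (maximal_mul maxM); [apply: alg_int_nat | case: maxM => [[]]].
Qed.

Lemma cong_mulr (y z t : L) : alg_int t -> cong y z -> cong (t * y) (t * z).
Proof. by rewrite /congM -mulrBr => Ot; apply: (maximal_mul maxM). Qed.

Lemma mpeval_add s t : cong (ev (mpadd s t)) (ev s + ev t).
Proof.
elim: s t => [|a s IHs] [|b t] /=; rewrite ?add0r ?addr0; try exact: (congM_refl maxM).
have -> : a%:R + x * ev s + (b%:R + x * ev t) =
  (a + b)%N%:R + x * (ev s + ev t) by rewrite natrD; ring.
by apply: (congM_add maxM); [apply: cong_mod | apply: cong_mulr].
Qed.

Lemma mpeval_scale a s : cong (ev (mpscale a s)) (a%:R * ev s).
Proof.
elim: s => [|b s IHs] /=; first by rewrite mulr0; apply: (congM_refl maxM).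
rewrite mulrDr mulrCA -natrM.
by apply: (congM_add maxM); [apply: cong_mod | apply: cong_mulr].
Qed.

Lemma mpeval_sub s t : cong (ev (mpsub s t)) (ev s - ev t).
Proof.
apply: (congM_trans maxM) (mpeval_add _ _) _; apply: (congM_add maxM).
  exact: (congM_refl maxM).
apply: (congM_trans maxM) (mpeval_scale _ _) _.
rewrite /congM opprK -{2}[ev t]mul1r -mulrDl mulrC natr1 prednK ?prime_gt0 //.
by apply: (maximal_mul maxM); [apply: mpeval_int | case: maxM => [[]]].
Qed.

Lemma mpeval_take s n : (size s <= n.+1)%N ->
  ev s = ev (take n s) + x ^+ n * (nth 0%N s n)%:R.
Proof.
elim: s n => [|a s IHs] n /=; first by rewrite nth_nil mulr0 addr0; case: n.
case: n => [|n]; last by rewrite ltnS => /IHs ->; rewrite /= exprS; ring.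
by case: s {IHs} => //= _; rewrite expr0; ring.
Qed.

Lemma mpsize_add s t n : (size s <= n)%N -> (size t <= n)%N -> (size (mpadd s t) <= n)%N.
Proof.
by elim: s t n => [|a s IHs] [|b t] [|n] //= ss st; apply: IHs.
Qed.

Lemma mpsize_mulX s : (size (mpmulX s) <= size red)%N.
Proof.
by apply: mpsize_add; rewrite ?size_map // size_take_min geq_minl.
Qed.

Lemma mpeval_mulX s : (size s <= size red)%N -> cong (ev (mpmulX s)) (x * ev s).
Proof.
move=> sz; have -> : x * ev s = ev (0%N :: s) by rewrite /= add0r.
rewrite (mpeval_take (s := 0%N :: s) (n := size red)) //.
apply: (congM_trans maxM) (mpeval_add _ _) _; apply: (congM_add maxM).
  exact: (congM_refl maxM).
apply: (congM_trans maxM) (mpeval_scale _ _) _; rewrite [X in cong _ X]mulrC.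
by apply: cong_mulr; [apply: alg_int_nat | apply: (congM_sym maxM)].
Qed.

Lemma mpsize_mul s t : (size t <= size red)%N -> (size (mpmul s t) <= size red)%N.
Proof.
move=> sz; elim: s => [|a s IHs] //=; apply: mpsize_add; first by rewrite size_map.
exact: mpsize_mulX.
Qed.

Lemma mpeval_mul s t : (size t <= size red)%N ->
  cong (ev (mpmul s t)) (ev s * ev t).
Proof.
move=> sz; elim: s => [|a s IHs] /=; first by rewrite mul0r; apply: (congM_refl maxM).
apply: (congM_trans maxM) (mpeval_add _ _) _.
rewrite mulrDl -mulrA; apply: (congM_add maxM); first exact: mpeval_scale.
apply: (congM_trans maxM) (mpeval_mulX _) _; first exact: mpsize_mul.
exact: cong_mulr.
Qed.

Hypothesis sz_red : (1 < size red)%N.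

Lemma mpsize_exp s n : (size s <= size red)%N -> (size (mpexp s n) <= size red)%N.
Proof.
by move=> sz; elim: n => [|n IHn] /=; [apply: ltnW | apply: mpsize_mul].
Qed.

Lemma mpeval_exp s n : (size s <= size red)%N -> cong (ev (mpexp s n)) (ev s ^+ n).
Proof.
move=> sz; elim: n => [|n IHn] /=.
  by rewrite mulr0 addr0 expr0; apply: (congM_refl maxM).
apply: (congM_trans maxM) (mpeval_mul _ _) _; first exact: mpsize_exp.
by rewrite exprS; apply: cong_mulr => //; apply: mpeval_int.
Qed.

Lemma mpeval_frobenius n :
  (size (mpfrobenius n) <= size red)%N /\ cong (ev (mpfrobenius n)) (x ^+ (p ^ n)).
Proof.
elim: n => [|n [szn IHn]] /=.
  split=> //; rewrite expn0 expr1 mulr0 addr0 mulr1 add0r.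
  exact: (congM_refl maxM).
split; first exact: mpsize_exp.
apply: (congM_trans maxM) (mpeval_exp _ _) _ => //.
rewrite expnSr exprM; apply: (congM_exp maxM) => //; first exact: mpeval_int.
exact: alg_int_exp.
Qed.

Lemma mpeval_all0 s : all (fun n => n == 0%N) s -> ev s = 0.
Proof. by elim: s => [|a s IHs] //= /andP[/eqP -> /IHs ->]; rewrite mulr0 addr0. Qed.

Lemma mpeval_X : ev [:: 0%N; 1%N] = x.
Proof. by rewrite /= mulr0 addr0 mulr1 add0r. Qed.

Lemma cong_frobenius_X n : cong (ev (mpsub (mpfrobenius n) [:: 0%N; 1%N])) (x ^+ (p ^ n) - x).
Proof.
apply: (congM_trans maxM) (mpeval_sub _ _) _; rewrite mpeval_X.
by apply: (congM_add maxM); [case: (mpeval_frobenius n) | apply: (congM_refl maxM)].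
Qed.

Lemma mpX_orderP d inv n : mpX_order d inv -> cong (x ^+ (p ^ n)) x -> (d %| n)%N.
Proof.
case/and4P => /eqP sz_d d_gt1 /mpeval_all0 eq_d /allP nz_lt.
have perd : cong (x ^+ (p ^ d)) x.
  have := congM_sym maxM (cong_frobenius_X d).
  by rewrite eq_d /congM subr0.
have perdm m : cong (x ^+ (p ^ (m * d))) x.
  elim: m => [|m IHm]; first by rewrite mul0n expn0 expr1; apply: (congM_refl maxM).
  rewrite mulSn expnD exprM; apply: (congM_trans maxM) IHm.
  by apply: (congM_exp maxM) => //; apply: alg_int_exp.
rewrite {1}(divn_eq n d) expnD exprM => pern.
have perr : cong (x ^+ (p ^ (n %% d))) x.
  apply: (congM_trans maxM) pern; apply: (congM_exp maxM) => //; first exact: alg_int_exp.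
  exact: (congM_sym maxM).
rewrite /dvdn; apply: contraT => nz_r; case: (maximal_not1 maxM).
have in_r : (n %% d)%N \in iota 1 d.-1.
  by rewrite mem_iota lt0n nz_r add1n prednK ?ltn_mod // ltnW.
set r := (n %% d)%N in perr in_r.
have := nz_lt r in_r; set D := mpsub (mpfrobenius r) _ => /mpeval_all0 eq1.
have sz_D : (size D <= size red)%N.
  by apply: mpsize_add; rewrite ?size_map //; case: (mpeval_frobenius r).
have MD : M (ev D).
  by have := maximal_add maxM (cong_frobenius_X r) perr; rewrite subrK.
have := congM_sym maxM (mpeval_sub (mpmul (nth [::] inv r) D) [:: 1%N]).
rewrite eq1 /congM subr0 /= mulr0 addr0 => M1.
have := maximal_sub maxM (mpeval_mul (nth [::] inv r) sz_D) M1.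
rewrite opprB addrC addrA subrK => /(maximal_add maxM) /(_ (maximal_mul maxM (mpeval_int (nth [::] inv r)) MD)).
by rewrite subrK.
Qed.

End ModularPolynomials.

(** * The permutations of nine roots *)

Section GaloisActionOnRoots.
Variables (F : fieldType) (L : splittingFieldType F) (rs : seq L).
Local Notation G := 'Gal({:L} / 1)%g.
Hypothesis rs_stable : forall (g : gal_of {:L}) x, x \in rs -> g x \in rs.

Definition root_map (g : gal_of {:L}) (t : seq_sub rs) : seq_sub rs :=
  SeqSub (rs_stable g (ssvalP t)).

Lemma root_map_inj g : injective (root_map g).
Proof. by move=> s t /(congr1 val) /= /fmorph_inj/val_inj. Qed.

Definition root_perm g : {perm seq_sub rs} := perm (@root_map_inj g).

Lemma root_permE g t : val (root_perm g t) = g (val t).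
Proof. by rewrite permE. Qed.

Lemma root_perm_morph : {in G &, {morph root_perm : g h / (g * h)%g}}.
Proof.
move=> g h _ _; apply/permP => t; apply/val_inj.
by rewrite permM !root_permE galMx.
Qed.
Canonical root_perm_morphism := Morphism root_perm_morph.

(** The automorphism [s] moves [x0] in a cycle whose length is a multiple of 5,
    so 5 divides the order of the permutation group of the roots, whose derived
    series is the image of that of the Galois group. *)
Lemma degree9_gal_der_transitive (s : gal_of {:L}) (x0 : L) :
  uniq rs -> size rs = 9%N ->
  (forall x y, x \in rs -> y \in rs -> exists g : gal_of {:L}, g x = y) ->
  x0 \in rs -> (forall n, (s ^+ n)%g x0 = x0 -> (5 %| n)%N) ->
  forall k x y, x \in rs -> y \in rs -> exists2 g, g \in (G^`(k))%g & g x = y.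
Proof.
move=> Urs sz9 trans rs_x0 ord5 k x y rs_x rs_y.
pose P := (root_perm_morphism @* G)%G.
have cardT : #|{: seq_sub rs}| = 9%N by rewrite card_seq_sub.
have trP : [transitive P, on [set: seq_sub rs]%SET | 'P].
  apply/imsetP; exists (SeqSub rs_x0); rewrite ?inE //.
  apply/setP => t; rewrite inE; apply/esym/orbitP.
  have [g gt] := trans _ _ rs_x0 (ssvalP t).
  exists (root_perm g); first by apply: mem_morphim; apply: mem_galG.
  by apply/val_inj; rewrite /= /aperm root_permE.
have P5 : (5 %| #|P|)%N.
  apply: dvdn_trans (order_dvdG (mem_morphim root_perm_morphism (mem_galG s) (mem_galG s))).
  apply: ord5; have := expg_order (root_perm s).
  rewrite -(morphX root_perm_morphism _ (mem_galG s)) => /permP/(_ (SeqSub rs_x0))/(congr1 val).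
  by rewrite perm1 /= root_permE.
have := degree9_der_transitive cardT trP P5 k.
rewrite -(morphim_der root_perm_morphism _ (subxx G)) => trD.
have inT (t : seq_sub rs) : t \in [set: seq_sub rs]%SET by rewrite inE.
have [_ /morphimP[g _ Gg ->] gxy] := atransP2 trD (inT (SeqSub rs_x)) (inT (SeqSub rs_y)).
by exists g => //; move/(congr1 val): gxy; rewrite /= /aperm root_permE.
Qed.

End GaloisActionOnRoots.

(** * The nonic *)

(** The expression is kept in every commutative ring, and transported by ring
    morphisms, so that its large coefficients are never evaluated. *)
Definition nonic_at (R : comNzRingType) (x : R) : R :=
  x ^+ 3 * (x ^+ 2 - 3 * x - 36) ^+ 3
  - 686 * (x - 6) * (x ^+ 2 - 45) * (x ^+ 2 - 72) ^+ 2.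

Lemma rmorph_nonic (R S : comNzRingType) (f : {rmorphism R -> S}) x :
  f (nonic_at x) = nonic_at (f x).
Proof. by rewrite /nonic_at !(rmorphB, rmorphM, rmorphXn, rmorph_nat). Qed.

Definition nonic : {poly int} := nonic_at 'X.

(** Large integers are written in base 1000, since a numeral stands for a unary
    number. *)
Lemma nonic_coefs : nonic = Poly
  [:: - (960 * 1000 * 1000 + 180 * 1000 + 480); 160 * 1000 * 1000 + 30 * 1000 + 80;
      48 * 1000 * 1000 + 9 * 1000 + 24; - (8 * 1000 * 1000 + 48 * 1000 + 160);
      - (789 * 1000 + 588); 132 * 1000 + 570; 4 * 1000 + 737; - 767; - 9; 1].
Proof. by rewrite /= !cons_poly_def mul0r add0r /nonic /nonic_at; ring. Qed.

Lemma nonic_size : size nonic = 10%N.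
Proof. by rewrite nonic_coefs (PolyK (c := 0)). Qed.

Lemma nonic_monic : nonic \is monic.
Proof. by rewrite monicE lead_coefE nonic_size nonic_coefs (PolyK (c := 0)). Qed.

Lemma nonic_horner (R : comNzRingType) (x : R) : (map_poly intr nonic).[x] = nonic_at x.
Proof.
rewrite -[LHS]/(horner_eval x (map_poly intr nonic)) !rmorph_nonic /=.
by rewrite map_polyX /horner_eval hornerX.
Qed.

Definition quintic11 : {poly int} := mpeval 'X [:: 10; 7; 5; 6; 8; 1]%N.
Definition quartic11 : {poly int} := mpeval 'X [:: 6; 8; 1; 5; 1]%N.

Lemma quintic11_Poly : quintic11 = Poly [:: 10; 7; 5; 6; 8; 1].
Proof. exact: mpeval_polyX. Qed.

Lemma quintic11_size : size quintic11 = 6%N.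
Proof. by rewrite quintic11_Poly (PolyK (c := 0)). Qed.

Lemma quintic11_monic : quintic11 \is monic.
Proof. by rewrite monicE lead_coefE quintic11_size quintic11_Poly (PolyK (c := 0)). Qed.

Lemma nonic_mod11 : exists k : {poly int}, nonic - quintic11 * quartic11 = 11 * k.
Proof.
exists (- (87 * 1000 * 1000 + 289 * 1000 + 140)
  + (14 * 1000 * 1000 + 548 * 1000 + 178) * 'X + (4 * 1000 * 1000 + 364 * 1000 + 448) * 'X^2
  - (731 * 1000 + 663) * 'X^3 - (71 * 1000 + 794) * 'X^4 + (12 * 1000 + 42) * 'X^5
  + 426 * 'X^6 - 74 * 'X^7 - 2 * 'X^8).
by rewrite /quintic11 /quartic11 /nonic /nonic_at /mpeval /=; ring.
Qed.

(** The reductions of [x ^+ 5] modulo [quintic11] and of [x ^+ 9] modulo [nonic],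
    with the inverses that show that these polynomials are irreducible modulo 11
    and modulo 13. *)
Definition red11 : seq nat := [:: 1; 4; 6; 5; 3]%N.
Definition inverses11 : seq (seq nat) :=
  [:: [::]; [:: 9; 4; 4; 8; 3]; [:: 3; 10; 1; 4; 6]; [:: 1; 7; 6; 2; 10];
      [:: 7; 9; 3; 8; 5]]%N.
Definition red13 : seq nat := [:: 12; 11; 2; 3; 7; 4; 8; 0; 9]%N.
Definition inverses13 : seq (seq nat) :=
  [:: [::]; [:: 7; 3; 1; 8; 0; 10; 11; 9; 8]; [:: 12; 5; 1; 0; 5; 2; 1; 9; 8];
      [:: 10; 9; 3; 1; 5; 12; 3; 10; 10]; [:: 5; 12; 1; 7; 5; 7; 4; 8];
      [:: 5; 1; 3; 0; 12; 10; 0; 7; 8]; [:: 4; 6; 1; 6; 9; 12; 8; 3; 9];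
      [:: 2; 11; 12; 12; 3; 12; 5; 1; 4]; [:: 9; 4; 9; 11; 4; 3; 10; 4; 10]]%N.

Lemma order11 : mpX_order 11 red11 5 inverses11.
Proof. by vm_compute. Qed.

Lemma order13 : mpX_order 13 red13 9 inverses13.
Proof. by vm_compute. Qed.

Lemma red11_quintic : exists k : {poly int}, 'X^5 - mpeval 'X red11 = quintic11 + 11 * k.
Proof.
exists (- ('X^4 + 'X^3 + 'X^2 + 'X + 1)).
by rewrite /quintic11 /mpeval /=; ring.
Qed.

Lemma red13_nonic : exists k : {poly int}, 'X^9 - mpeval 'X red13 = nonic + 13 * k.
Proof.
exists (73 * 1000 * 1000 + 860 * 1000 + 36 - (12 * 1000 * 1000 + 310 * 1000 + 7) * 'X
  - (3 * 1000 * 1000 + 693 * 1000 + 2) * 'X^2 + (619 * 1000 + 89) * 'X^3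
  + (60 * 1000 + 737) * 'X^4 - (10 * 1000 + 198) * 'X^5 - 365 * 'X^6 + 59 * 'X^7).
by rewrite /nonic /nonic_at /mpeval /=; ring.
Qed.

Section NonicRoots.
Variable L : splittingFieldType rat.
Local Notation alg_int := (integralOver (intr : int -> L)).

(** A power of the Frobenius automorphism that fixes [x] makes the same power of
    the Frobenius map fix the residue of [x]. *)
Lemma frobenius_order p red d inv (M : L -> Prop) x : prime p -> maximal_over p M ->
  alg_int x -> congM M (x ^+ size red) (mpeval x red) -> mpX_order p red d inv ->
  exists g : gal_of {:L}, forall n, (g ^+ n)%g x = x -> (d %| n)%N.
Proof.
move=> p_pr maxM Ox redP ord; have [g stab frob] := frobenius_element p_pr maxM Ox.
have sz_red : (1 < size red)%N by case/and4P: (ord) => /eqP ->.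
exists g => n gnx; apply: (mpX_orderP p_pr maxM Ox redP sz_red ord).
apply: (congM_sym maxM); rewrite -{1}gnx; exact: frobenius_iter.
Qed.

Lemma cong_reduction (p : nat) (red : seq nat) (h k : {poly int}) (M : L -> Prop) (x : L) :
  prime p -> maximal_over p M -> alg_int x ->
  'X^(size red) - mpeval 'X red = h + p%:R * k -> M (map_poly intr h).[x] ->
  congM M (x ^+ size red) (mpeval x red).
Proof.
move=> p_pr maxM Ox Dh Mh.
pose e : {rmorphism {poly int} -> L} := horner_eval x \o map_poly intr.
have eX : e 'X = x by rewrite /e /= map_polyX /horner_eval hornerX.
rewrite /congM -eX -rmorph_mpeval -rmorphXn -rmorphB Dh rmorphD rmorphM rmorph_nat.
apply: (maximal_add maxM Mh); rewrite mulrC.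
by apply: (maximal_mul maxM); [apply: alg_int_horner | case: maxM => [[]]].
Qed.

Section Roots.
Variable rs : seq L.
Hypothesis rsP : map_poly intr nonic = \prod_(x <- rs) ('X - x%:P).

Lemma nonic_rootE x : root (map_poly intr nonic) x = (x \in rs).
Proof. by rewrite rsP root_prod_XsubC. Qed.

Lemma nonic_size_roots : size rs = 9%N.
Proof.
have := congr1 (fun q : {poly L} => size q) rsP; rewrite size_prod_XsubC.
by rewrite size_map_poly_id0 ?(monicP nonic_monic) ?rmorph1 ?oner_eq0 // nonic_size => -[].
Qed.

Lemma nonic_root_int x : x \in rs -> alg_int x.
Proof. by rewrite -nonic_rootE; exists nonic => //; apply: nonic_monic. Qed.

Lemma nonic_root_stable (g : gal_of {:L}) x : x \in rs -> g x \in rs.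
Proof.
rewrite -!nonic_rootE => /(rmorph_root g); rewrite -map_poly_comp.
by congr (is_true (root _ _)); apply: eq_map_poly => a; rewrite /= rmorph_int.
Qed.

(** A Frobenius automorphism at 13 moves a root through nine distinct roots,
    so they are all of them; this gives separability as well. *)
Lemma nonic_roots_cyclic x : x \in rs ->
  uniq rs /\ exists g : gal_of {:L}, forall y, y \in rs -> exists n, (g ^+ n)%g x = y.
Proof.
move=> rs_x; have [M maxM] := maximal_over_exists L (isT : prime 13).
have Ox := nonic_root_int rs_x; have [k Dk] := red13_nonic.
have redP : congM M (x ^+ size red13) (mpeval x red13).
  apply: (cong_reduction (red := red13) (isT : prime 13) maxM Ox Dk).
  by rewrite (rootP _) ?nonic_rootE //; apply: (maximal0 maxM).
have [g ord_g] := frobenius_order (isT : prime 13) maxM Ox redP order13.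
pose s := [seq (g ^+ n)%g x | n <- iota 0 9].
have iter_rs n : (g ^+ n)%g x \in rs by apply: nonic_root_stable.
have inj m n : (m <= n < 9)%N -> (g ^+ m)%g x = (g ^+ n)%g x -> m = n.
  case/andP => le_mn lt_n eq_mn; have : (9 %| n - m)%N.
    have eq_x : (g ^+ m)%g ((g ^+ (n - m))%g x) = (g ^+ m)%g x.
      by rewrite -galMx -expgD subnK.
    by apply: ord_g; apply: fmorph_inj eq_x.
  have lt_nm : (n - m < 9)%N by apply: leq_ltn_trans lt_n; apply: leq_subr.
  rewrite /dvdn modn_small // subn_eq0 => le_nm.
  by apply/eqP; rewrite eqn_leq le_mn.
have Us : uniq s.
  rewrite map_inj_in_uniq ?iota_uniq // => m n; rewrite !mem_iota /= !add0n => lt_m lt_n.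
  have [le_mn | /ltnW le_nm] := leqP m n; first by apply: inj; rewrite le_mn.
  by move/esym => eq_nm; apply/esym/inj => //; rewrite le_nm.
have sub : {subset s <= rs} by move=> _ /mapP[n _ ->].
have le_sz : (size rs <= size s)%N by rewrite nonic_size_roots size_map size_iota.
have [eq_sz eq_s] := uniq_min_size Us sub le_sz.
split; first by rewrite -(eq_uniq eq_sz eq_s).
by exists g => y; rewrite -eq_s => /mapP[n _ ->]; exists n.
Qed.

(** A Frobenius automorphism at 11, at a root which reduces to a root of the
    quintic factor. *)
Lemma nonic_root_order5 :
  exists (g : gal_of {:L}) (x : L), x \in rs /\ forall n, (g ^+ n)%g x = x -> (5 %| n)%N.
Proof.
have [M maxM] := maximal_over_exists L (isT : prime 11).
have Oint (q : {poly int}) i : alg_int (map_poly (intr : int -> L) q)`_i.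
  by rewrite coef_map; apply: alg_int_int.
have [x rs_x Mx] : exists2 x, x \in rs & M (map_poly intr quintic11).[x].
  apply: (factor_root_mod maxM (g := map_poly intr quartic11)) => //.
  - exact: nonic_root_int.
  - by apply: monic_map; apply: quintic11_monic.
  - by rewrite size_map_poly_id0 ?(monicP quintic11_monic) ?rmorph1 ?oner_eq0 // quintic11_size.
  move=> i; have [k Dk] := nonic_mod11.
  rewrite -rsP -rmorphM -rmorphB Dk rmorphM rmorph_nat mulr_natl coefMn -mulr_natl mulrC.
  by apply: (maximal_mul maxM); [apply: Oint | case: maxM => [[]]].
have Ox := nonic_root_int rs_x; have [k Dk] := red11_quintic.
have redP := cong_reduction (red := red11) (isT : prime 11) maxM Ox Dk Mx.
have [g ord_g] := frobenius_order (isT : prime 11) maxM Ox redP order11.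
by exists g, x.
Qed.

Theorem nonic_der_transitive k x y : x \in rs -> y \in rs ->
  exists2 g, g \in ('Gal({:L} / 1)^`(k))%g & g x = y.
Proof.
have [g [x0 [rs_x0 ord5]]] := nonic_root_order5.
have [Urs [s Ds]] := nonic_roots_cyclic rs_x0.
apply: (degree9_gal_der_transitive nonic_root_stable Urs nonic_size_roots _ rs_x0 ord5).
move=> {}x {}y /Ds[m <-] /Ds[n <-]; exists ((s ^+ m)^-1 * s ^+ n)%g.
by rewrite galMx galVKx.
Qed.

Lemma nonic_roots_uniq : uniq rs.
Proof.
case: rs nonic_size_roots nonic_roots_cyclic => // x s _ /(_ x (mem_head x s)).
by case.
Qed.

End Roots.
End NonicRoots.

(** * Numbers expressible by radicals *)

Section RadicalValues.
Variable R : realType.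
Local Notation QtoC := (ratr : rat -> R[i]).

Lemma fmorph_alg (L : splittingFieldType rat) (iota : {rmorphism L -> R[i]}) (a : rat) :
  iota a%:A = ratr a.
Proof. by rewrite -in_algE -[LHS]/((iota \o in_alg L) a) fmorph_eq_rat. Qed.

Lemma algebraic_expn (z x : R[i]) n : (0 < n)%N -> z ^+ n = x ->
  algebraicOver QtoC x -> algebraicOver QtoC z.
Proof.
move=> n_gt0 zx alg_x; apply/integral_algebraic.
apply: (@integral_root _ _ (ratr : {rmorphism rat -> R[i]}) ('X^n - x%:P)).
- by rewrite monic_neq0 ?monicXnsubC.
- by rewrite rootE !hornerE zx subrr.
apply/integral_poly => i; rewrite coefB coefXn coefC; apply: integral_sub.
  exact: integral_nat.
by case: eqP => _; [apply/integral_algebraic | apply: integral0].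
Qed.

(** The list [s] contains the intermediate values of a computation of [z] by
    radicals: in every Galois extension of the rationals that contains them,
    [z] is fixed by a term of the derived series. *)
Definition solvable_number (z : R[i]) :=
  exists s : seq R[i], [/\ forall w, w \in s -> algebraicOver QtoC w, z \in s &
    forall (L : splittingFieldType rat) (iota : {rmorphism L -> R[i]}),
      (forall w, w \in s -> exists x, iota x = w) ->
    exists x k, iota x = z /\ der_fixed k x].

Lemma solvable_number_rat (q : rat) : solvable_number (ratr q).
Proof.
exists [:: ratr q]; split; rewrite ?mem_head //.
  by move=> w; rewrite inE => /eqP ->; apply: algebraic_id.
move=> L iota _; exists q%:A, 0%N.
by split; [apply: fmorph_alg | apply: der_fixed_alg].
Qed.

Lemma solvable_number2 (op : forall K : fieldType, K -> K -> K) x y :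
    (forall (K K' : fieldType) (h : {rmorphism K -> K'}) u v,
      h (op K u v) = op K' (h u) (h v)) ->
    (forall u v, algebraicOver QtoC u -> algebraicOver QtoC v -> algebraicOver QtoC (op _ u v)) ->
  solvable_number x -> solvable_number y -> solvable_number (op _ x y).
Proof.
move=> op_morph op_alg [s [alg_s sx Ps]] [t [alg_t ty Pt]].
exists (op _ x y :: s ++ t); split; rewrite ?mem_head //.
  move=> w; rewrite inE mem_cat => /or3P[/eqP -> | /alg_s // | /alg_t //].
  by apply: op_alg; [apply: alg_s | apply: alg_t].
move=> L iota st; have [|u [k [<- fu]]] := Ps L iota.
  by move=> w sw; apply: st; rewrite inE mem_cat sw orbT.
have [|v [m [<- fv]]] := Pt L iota.
  by move=> w tw; apply: st; rewrite inE mem_cat tw !orbT.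
exists (op L u v), (maxn k m); split; first exact: op_morph.
by apply: der_fixed2 => // g; apply: op_morph.
Qed.

Lemma solvable_number_root n (x z : R[i]) : (0 < n)%N -> z ^+ n = x ->
  solvable_number x -> solvable_number z.
Proof.
move=> n_gt0 zx [s [alg_s sx Ps]]; exists (z :: s); split; rewrite ?mem_head //.
  move=> w; rewrite inE => /predU1P[-> | /alg_s //].
  by apply: (algebraic_expn n_gt0 zx); apply: alg_s.
move=> L iota st; have [u Du] := st z (mem_head z s).
have [|v [k [Dv fv]]] := Ps L iota.
  by move=> w sw; apply: st; rewrite inE sw orbT.
exists u, k.+2; split=> //; apply: der_fixed_root n_gt0 _ fv.
by apply: (fmorph_inj iota); rewrite rmorphXn /= Du Dv.
Qed.

Lemma radical_value_solvable (a b c : rat) f (z : R[i]) :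
  radical_value (ratr a : R) (ratr b) (ratr c) f z -> solvable_number z.
Proof.
have ratC (q : rat) : (ratr q : R)%:C = ratr q by rewrite -(fmorph_eq_rat (real_complex R \o ratr)).
elim=> {f z}; rewrite ?ratC; try exact: solvable_number_rat.
- move=> _ _ x y _ Sx _ Sy; apply: (solvable_number2 (op := fun K u v => u + v)) Sx Sy.
    by move=> K K' h u v; rewrite rmorphD.
  exact: algebraic_add.
- move=> _ _ x y _ Sx _ Sy; apply: (solvable_number2 (op := fun K u v => u - v)) Sx Sy.
    by move=> K K' h u v; rewrite rmorphB.
  exact: algebraic_sub.
- move=> _ _ x y _ Sx _ Sy; apply: (solvable_number2 (op := fun K u v => u * v)) Sx Sy.
    by move=> K K' h u v; rewrite rmorphM.
  exact: algebraic_mul.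
- move=> _ _ x y _ Sx _ Sy _; apply: (solvable_number2 (op := fun K u v => u / v)) Sx Sy.
    by move=> K K' h u v; rewrite fmorph_div.
  exact: algebraic_div.
by move=> n n_ge2 _ x z _ Sx zx; apply: solvable_number_root zx Sx; apply: ltnW.
Qed.

(** A term of the derived series fixing [z] is transitive on the nine roots, so
    the relation between [z] and [t] holds with every root in place of [t], and
    a polynomial of degree at most 8 with nine roots vanishes, even at [c]. *)
Lemma nonic_not_solvable (t z : R[i]) (A B : {poly rat}) (c : rat) :
    root (map_poly intr nonic) t -> (size A <= 9)%N -> (size B <= 9)%N ->
    B.[c] = 0 -> A.[c] != 0 ->
    z ^+ 2 * (map_poly ratr B).[t] = (map_poly ratr A).[t] ->
  ~ solvable_number z.
Proof.
move=> root_t szA szB B0 A0 zt [s [alg_s sz Ps]].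
have [r Dr] := closed_field_poly_normal (map_poly intr nonic : {poly R[i]}).
have nonicQ (K : fieldType) (h : {rmorphism rat -> K}) :
    map_poly h (map_poly intr nonic) = map_poly intr nonic.
  by rewrite -map_poly_comp; apply: eq_map_poly => m; rewrite /= rmorph_int.
have mon (K : fieldType) : (map_poly intr nonic : {poly K}) \is monic.
  by apply: monic_map; apply: nonic_monic.
rewrite (monicP (mon _)) scale1r in Dr.
have [|L [iota in_s]] := number_field_exists (s := s ++ r).
  move=> w; rewrite mem_cat => /orP[/alg_s // | r_w].
  exists (map_poly intr nonic); first by rewrite monic_neq0.
  by rewrite nonicQ Dr root_prod_XsubC.
have [|x [k [Dx fx]]] := Ps L iota; first by move=> w sw; apply: in_s; rewrite mem_cat sw.
have [rs Drs] : exists rs, map iota rs = r.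
  have in_r w : w \in r -> exists y, iota y = w.
    by move=> r_w; apply: in_s; rewrite mem_cat r_w orbT.
  elim: (r) in_r => [|w r1 IHr] in_r; first by exists [::].
  have [y Dy] : exists y, iota y = w by apply: in_r; rewrite inE eqxx.
  have [|rs Drs] := IHr; first by move=> v r1v; apply: in_r; rewrite inE r1v orbT.
  by exists (y :: rs); rewrite /= Dy Drs.
have rsP : map_poly intr nonic = \prod_(y <- rs) ('X - y%:P).
  apply: (map_poly_inj iota); rewrite rmorph_prod -map_poly_comp.
  transitivity (map_poly intr nonic : {poly R[i]}).
    by apply: eq_map_poly => m; rewrite /= rmorph_int.
  rewrite Dr -Drs big_map; apply: eq_bigr => y _.
  by rewrite rmorphB /= map_polyX map_polyC.
have [y rs_y Dy] : exists2 y, y \in rs & iota y = t.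
  by move: root_t; rewrite Dr root_prod_XsubC -Drs => /mapP[y rs_y ->]; exists y.
pose AL := map_poly (in_alg L) A; pose BL := map_poly (in_alg L) B.
have iota_poly (q : {poly rat}) : map_poly iota (map_poly (in_alg L) q) = map_poly ratr q.
  by rewrite -map_poly_comp; apply: eq_map_poly => a /=; apply: fmorph_alg.
have xy : x ^+ 2 * BL.[y] = AL.[y].
  apply: (fmorph_inj iota); rewrite rmorphM rmorphXn /= -!horner_map /= !iota_poly.
  by rewrite Dx Dy.
pose P := x ^+ 2 *: BL - AL.
have rootP y' : y' \in rs -> root P y'.
  move=> rs_y'; have [g Gg <-] := nonic_der_transitive rsP k rs_y rs_y'.
  have gal_poly (q : {poly rat}) : (map_poly (in_alg L) q).[g y] = g (map_poly (in_alg L) q).[y].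
    rewrite -horner_map /= -map_poly_comp; congr _.[_]; apply: eq_map_poly => a /=.
    by rewrite linearZ rmorph1.
  rewrite rootE !hornerE !gal_poly -[x in x ^+ 2](fx g Gg) -rmorphXn -rmorphM /= xy.
  by rewrite subrr.
have P0 : P = 0.
  apply/eqP/negPn/negP => nzP; have := max_poly_roots nzP _ (nonic_roots_uniq rsP).
  rewrite (introT allP) // => /(_ isT); rewrite (nonic_size_roots rsP) ltnNge => /negP[].
  apply: leq_trans (size_polyD _ _) _; rewrite geq_max size_polyN !size_map_poly szA andbT.
  by apply: leq_trans (size_scale_leq _ _) _; rewrite size_map_poly.
have := congr1 (fun q : {poly L} => q.[in_alg L c]) P0.
rewrite /P hornerD hornerN hornerZ horner0 /AL /BL !horner_map B0 rmorph0 mulr0 sub0r.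
by move/eqP; rewrite oppr_eq0 fmorph_eq0 (negPf A0).
Qed.

End RadicalValues.

(** * Bisectors and incircle of a triangle with given sides *)

Section PlaneGeometry.
Variable R : realType.
Implicit Types (A B C D I u v : 'rV[R]_2) (x y z r l : R).

Lemma dotE u v : dot u v = u 0 0 * v 0 0 + u 0 1 * v 0 1.
Proof. by rewrite /dot big_ord_recl big_ord1; congr (_ * _ + u 0 _ * v 0 _); apply/val_inj. Qed.

Lemma dotC u v : dot u v = dot v u.
Proof. by rewrite !dotE; ring. Qed.

Lemma dotDl u v w : dot (u + v) w = dot u w + dot v w.
Proof. by rewrite !dotE !mxE; ring. Qed.

Lemma dotZl a u w : dot (a *: u) w = a * dot u w.
Proof. by rewrite !dotE !mxE; ring. Qed.

Lemma dotDr u v w : dot w (u + v) = dot w u + dot w v.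
Proof. by rewrite dotC dotDl !(dotC _ w). Qed.

Lemma dotZr a u w : dot w (a *: u) = a * dot w u.
Proof. by rewrite dotC dotZl dotC. Qed.

Lemma dot_combr u v w a b : dot w (a *: u + b *: v) = a * dot w u + b * dot w v.
Proof. by rewrite dotDr !dotZr. Qed.

Lemma dot_comb u v a b : dot (a *: u + b *: v) (a *: u + b *: v) =
  a ^+ 2 * dot u u + 2 * a * b * dot u v + b ^+ 2 * dot v v.
Proof. by rewrite dot_combr !dotDl !dotZl (dotC v u); ring. Qed.

Lemma dotN u : dot (- u) (- u) = dot u u.
Proof. by rewrite !dotE !mxE; ring. Qed.

Lemma edist_sqr A B x : 0 <= x -> edist A B = x <-> dot (B - A) (B - A) = x ^+ 2.
Proof.
move=> x_ge0; rewrite /edist /enorm; split=> [<-|->]; last by rewrite sqrtr_sqr ger0_norm.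
by rewrite sqr_sqrtr // dotE -!expr2 addr_ge0 ?sqr_ge0.
Qed.

Lemma edistC A B : edist A B = edist B A.
Proof. by rewrite /edist /enorm -dotN opprB. Qed.

Lemma dot_sides A B C x y z : edist A B = x -> edist A C = y -> edist B C = z ->
  dot (B - A) (C - A) = (x ^+ 2 + y ^+ 2 - z ^+ 2) / 2.
Proof.
have nonneg (P Q : 'rV[R]_2) : 0 <= edist P Q by apply: sqrtr_ge0.
move=> /[dup] <- /(edist_sqr _ _ (nonneg _ _)) AB /[dup] <- /(edist_sqr _ _ (nonneg _ _)) AC.
move=> /[dup] <- /(edist_sqr _ _ (nonneg _ _)) BC.
by rewrite -AB -AC -BC !dotE !mxE; field.
Qed.

(** The foot of the bisector divides the opposite side in the ratio of the
    adjacent sides. *)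
Lemma bisector_length_sides A B C x y z l :
  edist A B = z -> edist A C = y -> edist B C = x ->
  0 < x -> 0 < y -> 0 < z -> 0 < l ->
  l ^+ 2 * (y + z) ^+ 2 = y * z * ((y + z) ^+ 2 - x ^+ 2) ->
  bisector_length A B C l.
Proof.
move=> AB AC BC x_gt0 y_gt0 z_gt0 l_gt0 lP.
have ee := (edist_sqr A B (ltW z_gt0)).1 AB.
have ff := (edist_sqr A C (ltW y_gt0)).1 AC.
have ef := dot_sides AB AC BC.
pose D := (1 - z / (y + z)) *: B + (z / (y + z)) *: C.
have yz_gt0 : 0 < y + z by apply: addr_gt0.
have yz0 : y + z != 0 by rewrite gt_eqF.
have DA : D - A = (y / (y + z)) *: (B - A) + (z / (y + z)) *: (C - A).
  by apply/rowP => i; rewrite !mxE; field.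
have dd : dot (D - A) (D - A) = l ^+ 2.
  rewrite DA dot_comb ee ff ef.
  apply: (mulIf (expf_neq0 2 yz0)); rewrite lP; field.
  by rewrite yz0.
have nD : edist A D = l by apply/edist_sqr => //; apply: ltW.
exists D; split=> //.
  exists (z / (y + z)) => //; apply/andP; split; first by rewrite divr_ge0 // ltW.
  by rewrite ler_pdivrMr // mul1r lerDr ltW.
rewrite /angle -/(edist A D) -/(edist A B) -/(edist A C) AB AC nD; congr acos.
rewrite [dot (D - A) _]dotC DA !dot_combr (dotC (C - A)) ee ff ef.
by field; rewrite yz0 !gt_eqF.
Qed.

(** Here [x], [y], [z] are the distances from [A], [B], [C] to the contact
    points of the incircle, so the weights are the opposite sides. *)
Definition incenter A B C x y z : 'rV[R]_2 :=
  (2 * (x + y + z))^-1 *: ((y + z) *: A + (z + x) *: B + (x + y) *: C).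

Lemma tangent_to_side A B C x y z r : 0 < x -> 0 < y -> 0 < z -> 0 <= r ->
  edist A B = x + y -> edist B C = y + z -> edist C A = z + x ->
  r ^+ 2 * (x + y + z) = x * y * z ->
  tangent_to_segment (incenter A B C x y z) r B C.
Proof.
move=> x_gt0 y_gt0 z_gt0 r_ge0 AB BC CA rP.
have BA := AB; rewrite edistC in BA; have AC := CA; rewrite edistC in AC.
have gg := (edist_sqr B A (ltW (addr_gt0 x_gt0 y_gt0))).1 BA.
have kk := (edist_sqr B C (ltW (addr_gt0 y_gt0 z_gt0))).1 BC.
have gk := dot_sides BA BC AC.
have s_gt0 : 0 < x + y + z by rewrite !addr_gt0.
have s0 : x + y + z != 0 by rewrite gt_eqF.
have yz_gt0 : 0 < y + z by rewrite addr_gt0.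
have yz0 : y + z != 0 by rewrite gt_eqF.
pose I := incenter A B C x y z.
pose T := (1 - y / (y + z)) *: B + (y / (y + z)) *: C.
have TI : T - I = (y / (y + z) - (x + y) / (2 * (x + y + z))) *: (C - B)
    + (- ((y + z) / (2 * (x + y + z)))) *: (A - B).
  by apply/rowP => i; rewrite !mxE; field; rewrite yz0 s0.
exists T; split.
- exists (y / (y + z)) => //; apply/andP; split; first by rewrite divr_ge0 // ltW.
  by rewrite ler_pdivrMr // mul1r lerDl ltW.
- rewrite TI dotC dot_combr kk (dotC (C - B)) gk; field.
  by rewrite yz0 s0.
apply/edist_sqr => //.
rewrite TI dot_comb (dotC (C - B)) gg kk gk.
apply: (mulIf s0); rewrite rP; field.
by rewrite yz0 s0.
Qed.

Lemma incenter_rot A B C x y z : incenter B C A y z x = incenter A B C x y z.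
Proof. by apply/rowP => i; rewrite !mxE addrAC -[y + z + x]addrC addrA; congr (_ * _); ring. Qed.

Lemma inradius_tangents (t : triangle R) x y z r :
  0 < x -> 0 < y -> 0 < z -> 0 < r ->
  edist (vA t) (vB t) = x + y -> edist (vB t) (vC t) = y + z -> edist (vC t) (vA t) = z + x ->
  r ^+ 2 * (x + y + z) = x * y * z -> is_inradius t r.
Proof.
move=> x_gt0 y_gt0 z_gt0 r_gt0 AB BC CA rP; split=> //.
exists (incenter (vA t) (vB t) (vC t) x y z); split.
- by apply: tangent_to_side => //; apply: ltW.
- by rewrite -incenter_rot; apply: tangent_to_side => //; [apply: ltW|lra].
by rewrite -2!incenter_rot; apply: tangent_to_side => //; [apply: ltW|lra].
Qed.

(** Heron's formula gives the height over the side [y + z], which is put on the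
    first coordinate axis. *)
Lemma triangle_of_tangents x y z S : 0 < x -> 0 < y -> 0 < z -> 0 < S ->
  S ^+ 2 = x * y * z * (x + y + z) ->
  exists t : triangle R, [/\ edist (vA t) (vB t) = x + y, edist (vB t) (vC t) = y + z,
    edist (vC t) (vA t) = z + x & area t = S].
Proof.
move=> x_gt0 y_gt0 z_gt0 S_gt0 SP.
have a_gt0 : 0 < y + z by rewrite addr_gt0.
have a0 : y + z != 0 by rewrite gt_eqF.
pose X := ((x + y) ^+ 2 + (y + z) ^+ 2 - (z + x) ^+ 2) / (2 * (y + z)).
pose H := 2 * S / (y + z).
pose mk a b : 'rV[R]_2 := \row_i (if i == 0 then a else b).
have crossE : cross (mk 0 0 - mk X H) (mk (y + z) 0 - mk X H) = 2 * S.
  by rewrite /cross !mxE /= /H; field.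
have nd : cross (mk 0 0 - mk X H) (mk (y + z) 0 - mk X H) != 0.
  by rewrite crossE gt_eqF // mulr_gt0.
have XH : X ^+ 2 + H ^+ 2 = (x + y) ^+ 2.
  have H2 : H ^+ 2 = 4 * S ^+ 2 / (y + z) ^+ 2 by rewrite /H; field.
  by rewrite H2 SP /X; field.
exists (Triangle nd); split=> /=.
- apply/edist_sqr; first by rewrite ltW ?addr_gt0.
  by rewrite dotE !mxE /= -XH; ring.
- apply/edist_sqr; first by rewrite ltW ?addr_gt0.
  by rewrite dotE !mxE /=; ring.
- apply/edist_sqr; first by rewrite ltW ?addr_gt0.
  rewrite dotE !mxE /=.
  have -> : (X - (y + z)) * (X - (y + z)) + (H - 0) * (H - 0) =
     X ^+ 2 + H ^+ 2 - 2 * X * (y + z) + (y + z) ^+ 2 by ring.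
  by rewrite XH /X; field.
rewrite /area /= crossE ger0_norm; first by field.
by rewrite mulr_ge0 // ltW.
Qed.

End PlaneGeometry.

(** * The solution of the bisector equations *)

Section ExampleTriangle.
Variable R : realType.
Implicit Types (a b e r u v w x y z h : R).

(** Among the real roots of the nonic, this is the one that gives positive
    tangent lengths. *)
Lemma nonic_real_root : exists2 y : R, 26 <= y <= 27 & nonic_at y = 0.
Proof.
have le_ab : 26 <= 27 :> R by lra.
have [|y y_in /rootP] := poly_ivt (p := map_poly intr nonic) le_ab.
  by rewrite !nonic_horner /nonic_at; lra.
by rewrite nonic_horner => Fy; exists y.
Qed.

Lemma cubic_root e r a b : a <= b ->
  (a ^+ 3 - a ^+ 2 + e * a - r) * (b ^+ 3 - b ^+ 2 + e * b - r) < 0 ->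
  exists2 u, a < u < b & u ^+ 3 - u ^+ 2 + e * u - r = 0.
Proof.
move=> le_ab sgn; pose p : {poly R} := 'X^3 - 'X^2 + e *: 'X - r%:P.
have pE x : p.[x] = x ^+ 3 - x ^+ 2 + e * x - r by rewrite /p !hornerE.
have [|u u_in /rootP pu] := poly_ivtoo (p := p) le_ab; first by rewrite !pE.
by exists u => //; rewrite -pE.
Qed.

Lemma cubic_vieta e r u v w : u != v -> v != w -> u != w ->
  u ^+ 3 - u ^+ 2 + e * u - r = 0 -> v ^+ 3 - v ^+ 2 + e * v - r = 0 ->
  w ^+ 3 - w ^+ 2 + e * w - r = 0 ->
  [/\ u + v + w = 1, u * v + v * w + w * u = e & u * v * w = r].
Proof.
move=> uv vw uw pu pv pw.
have Q1 : u ^+ 2 + u * v + v ^+ 2 - (u + v) + e = 0.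
  have nz : u - v != 0 by rewrite subr_eq0.
  by apply: (mulfI nz); rewrite mulr0 -[RHS](subrr 0) -{1}pu -pv; ring.
have Q2 : u ^+ 2 + u * w + w ^+ 2 - (u + w) + e = 0.
  have nz : u - w != 0 by rewrite subr_eq0.
  by apply: (mulfI nz); rewrite mulr0 -[RHS](subrr 0) -{1}pu -pw; ring.
have S1 : u + v + w = 1.
  have nz : v - w != 0 by rewrite subr_eq0.
  apply/eqP; rewrite -subr_eq0; apply/eqP.
  by apply: (mulfI nz); rewrite mulr0 -[RHS](subrr 0) -{1}Q1 -Q2; ring.
have Du : u = 1 - v - w by rewrite -S1; ring.
have E2 : u * v + v * w + w * u = e.
  by apply/eqP; rewrite -subr_eq0 -[0](oppr0) -Q1 Du; apply/eqP; ring.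
split=> //; rewrite -[RHS]addr0 -pu -E2 Du; ring.
Qed.

(** Up to a factor common to the three vertices, [psi u] is the inverse square of
    the bisector from the vertex with reduced tangent length [u]. *)
Definition psi u : R := (1 - u) * (1 + u) ^+ 2 / u.

Lemma psi_symmetric u v w e r : 0 < u -> 0 < v -> 0 < w ->
  u + v + w = 1 -> u * v + v * w + w * u = e -> u * v * w = r ->
  [/\ psi u + psi v + psi w = e / r + 1 + 2 * e,
      psi u * psi v + psi v * psi w + psi w * psi u =
        ((1 - r) ^+ 2 + 2 * (1 - r) * e ^+ 2) / r + 2 - 6 * r + 3 * (1 + e) ^+ 2 &
      psi u * psi v * psi w = (e - r) * (2 + e + r) ^+ 2 / r].
Proof.
move=> u_gt0 v_gt0 w_gt0 S1 <- <-; have -> : w = 1 - u - v by rewrite -S1; ring.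
have w0 : 1 - u - v != 0 by rewrite gt_eqF // -S1; lra.
by split; rewrite /psi; field; rewrite w0 !gt_eqF.
Qed.

Lemma psi_decreasing u v : 0 < u -> u < v -> psi v < psi u.
Proof.
move=> u_gt0 uv; have v_gt0 : 0 < v by apply: lt_trans uv.
rewrite -subr_gt0; have -> : psi u - psi v = (v - u) * ((u * v)^-1 + 1 + u + v).
  by rewrite /psi; field; rewrite !gt_eqF.
by rewrite mulr_gt0 ?subr_gt0 // !addr_gt0 // invr_gt0 mulr_gt0.
Qed.

Lemma ordered_in_triple h x y z : 0 < h -> y < x -> z < y ->
  [|| 14 * x == 9 * h, 14 * x == 4 * h | 14 * x == h] ->
  [|| 14 * y == 9 * h, 14 * y == 4 * h | 14 * y == h] ->
  [|| 14 * z == 9 * h, 14 * z == 4 * h | 14 * z == h] ->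
  [/\ 14 * x = 9 * h, 14 * y = 4 * h & 14 * z = h].
Proof.
move=> h_gt0 yx zy /or3P[] /eqP Dx /or3P[] /eqP Dy /or3P[] /eqP Dz; split; lra.
Qed.

(** For the root [y] between 26 and 27, the formulas for [r] and [e] below make
    the cubic with elementary symmetric functions 1, [e], [r] change sign three
    times between 0 and 1.  Its roots [u], [v], [w] have values of [psi] whose
    elementary symmetric functions are those of 9/14, 4/14 and 1/14 times [h]
    (the third one thanks to the nonic), and [psi] is decreasing, so the values
    are these, in this order. *)
Lemma tangent_lengths_exist : exists y u v w h : R,
  [/\ 26 <= y <= 27 /\ nonic_at y = 0, [/\ 0 < u, 0 < v, 0 < w & u + v + w = 1],
      u * v * w * (y ^+ 2 - 45) = 9,
      14 * psi u = 9 * h /\ 14 * psi v = 4 * h /\ 14 * psi w = h &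
      y * (y ^+ 2 - 3 * y - 36) * ((1 - u) * (1 - v) * (1 - w)) = 9 * h * (y - 6)].
Proof.
have [y y_in Fy] := nonic_real_root.
have y2_gt0 : 0 < y ^+ 2 - 45 by nra.
have y9_gt0 : 0 < y - 9 by lra.
have [y20 y90] : y ^+ 2 - 45 != 0 /\ y - 9 != 0 by rewrite !gt_eqF.
pose r := 9 / (y ^+ 2 - 45).
pose e := 3 * (2 * y - 15) * (y - 3) / ((y ^+ 2 - 45) * (y - 9)).
pose h := 2 * y * (y - 6) * (y ^+ 2 - 3 * y - 36) / (3 * (y ^+ 2 - 45) * (y - 9)).
have cE x : x ^+ 3 - x ^+ 2 + e * x - r = ((x ^+ 3 - x ^+ 2) * ((y ^+ 2 - 45) * (y - 9))
    + 3 * (2 * y - 15) * (y - 3) * x - 9 * (y - 9)) / ((y ^+ 2 - 45) * (y - 9)).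
  by rewrite /e /r; field; rewrite y20 y90.
have den_gt0 : 0 < (y ^+ 2 - 45) * (y - 9) by rewrite mulr_gt0.
(* The roots are close to 0.09, 0.22 and 0.69. *)
have c0 : 0 ^+ 3 - 0 ^+ 2 + e * 0 - r < 0 by rewrite cE pmulr_llt0 ?invr_gt0 //; nra.
have c1 : 0 < (3 / 20) ^+ 3 - (3 / 20) ^+ 2 + e * (3 / 20) - r.
  by rewrite cE pmulr_lgt0 ?invr_gt0 //; nra.
have c2 : (9 / 20) ^+ 3 - (9 / 20) ^+ 2 + e * (9 / 20) - r < 0.
  by rewrite cE pmulr_llt0 ?invr_gt0 //; nra.
have c3 : 0 < 1 ^+ 3 - 1 ^+ 2 + e * 1 - r.
  by rewrite cE pmulr_lgt0 ?invr_gt0 //; nra.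
have [||u /andP[u_gt0 u_lt] pu] := @cubic_root e r 0 (3 / 20).
- by lra.
- by rewrite nmulr_rlt0.
have [||v /andP[v_gt v_lt] pv] := @cubic_root e r (3 / 20) (9 / 20).
- by lra.
- by rewrite pmulr_rlt0.
have [||w /andP[w_gt w_lt] pw] := @cubic_root e r (9 / 20) 1.
- by lra.
- by rewrite nmulr_rlt0.
have uv : u < v by lra.
have vw : v < w by lra.
have [|||S1 S2 S3] := cubic_vieta _ _ _ pu pv pw.
- by rewrite lt_eqF.
- by rewrite lt_eqF.
- by rewrite lt_eqF // (lt_trans uv).
have v_gt0 : 0 < v by lra.
have w_gt0 : 0 < w by lra.
have [X1 X2 X3] := psi_symmetric u_gt0 v_gt0 w_gt0 S1 S2 S3.
have {}X1 : psi u + psi v + psi w = h by rewrite X1 /e /r /h; field; rewrite y20 y90.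
have {}X2 : psi u * psi v + psi v * psi w + psi w * psi u = h ^+ 2 / 4.
  by rewrite X2 /e /r /h; field; rewrite y20 y90.
have {}X3 : psi u * psi v * psi w = 9 / 686 * h ^+ 3.
  transitivity (9 / 686 * h ^+ 3 - 8 * (y - 6) ^+ 3 /
      (2058 * (y ^+ 2 - 45) ^+ 3 * (y - 9) ^+ 3) * nonic_at y).
    by rewrite X3 /e /r /h /nonic_at; field; rewrite y20 y90.
  by rewrite Fy mulr0 subr0.
have y6_gt0 : 0 < y - 6 by clear -y_in; lra.
have h_gt0 : 0 < h.
  have q_gt0 : 0 < y ^+ 2 - 3 * y - 36 by clear -y_in; nra.
  have y_gt0 : 0 < y by clear -y_in; lra.
  by rewrite divr_gt0 // !mulr_gt0.
have roots x : x ^+ 3 - (psi u + psi v + psi w) * x ^+ 2 +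
    (psi u * psi v + psi v * psi w + psi w * psi u) * x - psi u * psi v * psi w = 0 ->
    [|| 14 * x == 9 * h, 14 * x == 4 * h | 14 * x == h].
  rewrite X1 X2 X3 => xP; rewrite -![14 * x == _]subr_eq0 -!mulf_eq0 mulrA -[0](mulr0 2744) -xP.
  by apply/eqP; field.
have [Ru Rv Rw] : [/\ [|| 14 * psi u == 9 * h, 14 * psi u == 4 * h | 14 * psi u == h],
  [|| 14 * psi v == 9 * h, 14 * psi v == 4 * h | 14 * psi v == h] &
  [|| 14 * psi w == 9 * h, 14 * psi w == 4 * h | 14 * psi w == h]].
  by split; apply: roots; ring.
have psi_uv := psi_decreasing u_gt0 uv; have psi_vw := psi_decreasing v_gt0 vw.
exists y, u, v, w, h; split=> //.
- by rewrite S3 /r; field.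
- by have [] := ordered_in_triple h_gt0 psi_uv psi_vw Ru Rv Rw; split.
have -> : (1 - u) * (1 - v) * (1 - w) = e - r.
  by rewrite -S2 -S3; have -> : w = 1 - u - v by [rewrite -S1; ring]; ring.
by rewrite /e /r /h; field; rewrite y20 y90.
Qed.

(** With [p] the semiperimeter, [P2] is the value of [p ^+ 2] for which the
    bisectors have lengths 2, 3 and 6 and not just these ratios. *)
Lemma triangle_2_3_6 : exists (y r : R) (t : triangle R),
  [/\ nonic_at y = 0, has_bisectors t 2 3 6 /\ is_inradius t r,
      r ^+ 2 * (14 * (y - 6) * (y ^+ 2 - 45)) = 9 * y * (y ^+ 2 - 3 * y - 36),
      area t ^+ 2 * (196 * (y - 6) ^+ 2 * (y ^+ 2 - 45)) = 9 * (y * (y ^+ 2 - 3 * y - 36)) ^+ 2 &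
      perimeter t ^+ 2 * (7 * (y - 6)) = 2 * (y * (y ^+ 2 - 3 * y - 36))].
Proof.
have [y [u [v [w [h [[/andP[y_ge y_le] Fy] [u_gt0 v_gt0 w_gt0 S1] uvw [psi_u [psi_v psi_w]] Ph]]]]]] :=
  tangent_lengths_exist.
have y6_gt0 : 0 < y - 6 by clear -y_ge; lra.
have y2_gt0 : 0 < y ^+ 2 - 45 by clear -y_ge; nra.
have q_gt0 : 0 < y * (y ^+ 2 - 3 * y - 36) by clear -y_ge; apply: mulr_gt0; [lra|nra].
have y60 : y - 6 != 0 by rewrite gt_eqF.
have y20 : y ^+ 2 - 45 != 0 by rewrite gt_eqF.
pose P2 := y * (y ^+ 2 - 3 * y - 36) / (14 * (y - 6)).
have P2_gt0 : 0 < P2 by rewrite divr_gt0 // mulr_gt0.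
pose p := Num.sqrt P2.
have p_gt0 : 0 < p by rewrite sqrtr_gt0.
have p2 : p ^+ 2 = P2 by rewrite sqr_sqrtr // ltW.
have Ph2 : 14 * P2 * ((1 - u) * (1 - v) * (1 - w)) = 9 * h.
  apply: (mulIf y60); rewrite -Ph /P2; field; exact: y60.
pose r2 := P2 * (u * v * w).
have uvw_gt0 : 0 < u * v * w by rewrite !mulr_gt0.
pose r := Num.sqrt r2.
have r2_gt0 : 0 < r2 by rewrite mulr_gt0.
have r_gt0 : 0 < r by rewrite sqrtr_gt0.
have rr : r ^+ 2 = r2 by rewrite sqr_sqrtr // ltW.
have duvw : u * v * w = 9 / (y ^+ 2 - 45) by rewrite -uvw; field.
pose S := p * r.
have S_gt0 : 0 < S by rewrite mulr_gt0.
have S2 : S ^+ 2 = P2 ^+ 2 * (u * v * w) by rewrite /S exprMn p2 rr /r2; ring.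
have [||||| t [AB BC CA tS]] := @triangle_of_tangents R (p * u) (p * v) (p * w) S; try exact: mulr_gt0.
  have -> : p * u * (p * v) * (p * w) * (p * u + p * v + p * w) =
    (p ^+ 2) ^+ 2 * (u * v * w) * (u + v + w) by ring.
  by rewrite S1 S2 p2 mulr1.
have psiE (x : R) : 0 < x -> (1 - x) * (1 + x) ^+ 2 = psi x * x.
  by move=> x_gt0; rewrite /psi divfK ?gt_eqF.
have Dw : w = 1 - u - v by rewrite -S1; ring.
have u1 : 1 - u != 0 by rewrite gt_eqF //; lra.
have v1 : 1 - v != 0 by rewrite gt_eqF //; lra.
have w1 : 1 - w != 0 by rewrite gt_eqF //; lra.
(* The three bisector equations divided by a power of [p]. *)
have keyA : (1 + u) ^+ 2 = P2 * (1 - v) * (1 - w) * u.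
  apply: (mulfI u1); apply: (mulfI (_ : 14 != 0)); first by lra.
  by rewrite psiE // [LHS]mulrA psi_u -Ph2; ring.
have keyB : 9 * (1 + v) ^+ 2 = 4 * P2 * (1 - w) * (1 - u) * v.
  apply: (mulfI v1); apply: (mulfI (_ : 14 != 0)); first by lra.
  have -> : 14 * ((1 - v) * (9 * (1 + v) ^+ 2)) = 9 * (14 * ((1 - v) * (1 + v) ^+ 2)) by ring.
  rewrite psiE // [14 * _]mulrA psi_v; have -> : 9 * (4 * h * v) = 4 * v * (9 * h) by ring.
  by rewrite -Ph2; ring.
have keyC : 36 * (1 + w) ^+ 2 = 4 * P2 * (1 - u) * (1 - v) * w.
  apply: (mulfI w1); apply: (mulfI (_ : 14 != 0)); first by lra.
  have -> : 14 * ((1 - w) * (36 * (1 + w) ^+ 2)) = 36 * (14 * ((1 - w) * (1 + w) ^+ 2)) by ring.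
  rewrite psiE // [14 * _]mulrA psi_w; have -> : 36 * (h * w) = 4 * w * (9 * h) by ring.
  by rewrite -Ph2; ring.
have pos2 (a b : R) : 0 < a -> 0 < b -> 0 < p * a + p * b.
  by move=> a_gt0 b_gt0; rewrite addr_gt0 // mulr_gt0.
have r_rel : r ^+ 2 * (p * u + p * v + p * w) = p * u * (p * v) * (p * w).
  have -> : p * u + p * v + p * w = p by rewrite -!mulrDr S1 mulr1.
  by rewrite rr /r2 -p2; ring.
exists y, r, t; split=> //.
- split; last first.
    by apply: (inradius_tangents _ _ _ _ AB BC CA) => //; apply: mulr_gt0.
  have AC := CA; rewrite edistC in AC; have CB := BC; rewrite edistC in CB.
  have BA := AB; rewrite edistC in BA.
  split.
  + apply: (bisector_length_sides AB AC BC) => //; try exact: pos2.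
    have -> : p * w + p * u + (p * u + p * v) = p * (1 + u) by rewrite -S1; ring.
    have -> : p * w + p * u = p * (1 - v) by rewrite -S1; ring.
    have -> : p * u + p * v = p * (1 - w) by rewrite -S1; ring.
    have -> : p * v + p * w = p * (1 - u) by rewrite -S1; ring.
    have -> : 2 ^+ 2 * (p * (1 + u)) ^+ 2 = 4 * p ^+ 2 * (1 + u) ^+ 2 by ring.
    by rewrite keyA -p2; ring.
  + apply: (bisector_length_sides BC BA CA) => //; try exact: pos2.
    have -> : p * u + p * v + (p * v + p * w) = p * (1 + v) by rewrite -S1; ring.
    have -> : p * u + p * v = p * (1 - w) by rewrite -S1; ring.
    have -> : p * v + p * w = p * (1 - u) by rewrite -S1; ring.
    have -> : p * w + p * u = p * (1 - v) by rewrite -S1; ring.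
    have -> : 3 ^+ 2 * (p * (1 + v)) ^+ 2 = p ^+ 2 * (9 * (1 + v) ^+ 2) by ring.
    by rewrite keyB -p2; ring.
  apply: (bisector_length_sides CA CB AB) => //; try exact: pos2.
  have -> : p * v + p * w + (p * w + p * u) = p * (1 + w) by rewrite -S1; ring.
  have -> : p * w + p * u = p * (1 - v) by rewrite -S1; ring.
  have -> : p * v + p * w = p * (1 - u) by rewrite -S1; ring.
  have -> : p * u + p * v = p * (1 - w) by rewrite -S1; ring.
  have -> : 6 ^+ 2 * (p * (1 + w)) ^+ 2 = p ^+ 2 * (36 * (1 + w) ^+ 2) by ring.
  by rewrite keyC -p2; ring.
- by rewrite rr /r2 /P2 duvw; field; rewrite y60 y20.
- by rewrite tS S2 /P2 duvw; field; rewrite y60 y20.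
rewrite /perimeter AB BC CA.
have -> : p * v + p * w + (p * w + p * u) + (p * u + p * v) = 2 * p * (u + v + w) by ring.
by rewrite S1 mulr1 exprMn p2 /P2; field; rewrite y60.
Qed.

End ExampleTriangle.

(** * No formula in radicals *)

Section NotExpressible.
Variable R : realType.

(** The numerator and the denominator are functions on all commutative rings
    that commute with morphisms, so that they can be read as polynomials and as
    numbers. *)
Lemma root_relation_not_solvable (y q : R) (num den : forall S : comNzRingType, S -> S) :
    (forall (S T : comNzRingType) (f : {rmorphism S -> T}) x, f (num S x) = num T (f x)) ->
    (forall (S T : comNzRingType) (f : {rmorphism S -> T}) x, f (den S x) = den T (f x)) ->
    (size (num {poly rat} 'X) <= 9)%N -> (size (den {poly rat} 'X) <= 9)%N ->
    den rat 6 = 0 -> num rat 6 != 0 ->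
    nonic_at y = 0 -> q ^+ 2 * den R y = num R y ->
  ~ solvable_number q%:C.
Proof.
move=> morph_num morph_den sz_num sz_den den6 num6 Fy rel.
have rootE6 (ex : forall S : comNzRingType, S -> S) :
    (forall (S T : comNzRingType) (f : {rmorphism S -> T}) x, f (ex S x) = ex T (f x)) ->
    (ex {poly rat} 'X).[6] = ex rat 6.
  move=> morph; pose e : {rmorphism {poly rat} -> rat} := horner_eval (6 : rat).
  have eX : e 'X = 6 := hornerX 6.
  by rewrite -[LHS]/(e (ex {poly rat} 'X)) morph eX.
have rootEy (ex : forall S : comNzRingType, S -> S) :
    (forall (S T : comNzRingType) (f : {rmorphism S -> T}) x, f (ex S x) = ex T (f x)) ->
    (map_poly ratr (ex {poly rat} 'X)).[y%:C] = (ex R y)%:C.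
  move=> morph.
  pose e : {rmorphism {poly rat} -> R[i]} := horner_eval y%:C \o map_poly ratr.
  have eX : e 'X = y%:C by rewrite /e /= map_polyX /horner_eval hornerX.
  rewrite -[LHS]/(e (ex {poly rat} 'X)) -[RHS]/(real_complex R (ex R y)).
  by rewrite (morph _ _ e) eX morph.
apply: (nonic_not_solvable (t := y%:C) _ sz_num sz_den (c := 6)).
- by rewrite rootE nonic_horner -rmorph_nonic /= Fy rmorph0.
- by rewrite rootE6.
- by rewrite rootE6.
by rewrite !rootEy // -rmorphXn -rmorphM /= rel.
Qed.

Lemma expresses_solvable f (Q : triangle R -> R -> Prop) (t : triangle R) (q : R) :
  expresses f Q -> has_bisectors t 2 3 6 -> Q t q -> solvable_number q%:C.
Proof.
move=> fQ bis Qq; apply: (@radical_value_solvable R 2 3 6 f).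
by rewrite !rmorph_nat; apply: fQ Qq => //; lra.
Qed.

Lemma size_le_coefs (S : comNzRingType) (p : {poly S}) (s : seq S) n :
  p = Poly s -> (size s <= n)%N -> (size p <= n)%N.
Proof. by move=> ->; apply: leq_trans; apply: size_Poly. Qed.

Definition inradius_num (S : comNzRingType) (x : S) := 9 * x * (x ^+ 2 - 3 * x - 36).
Definition inradius_den (S : comNzRingType) (x : S) := 14 * (x - 6) * (x ^+ 2 - 45).

Lemma size_inradius_num (S : comNzRingType) : (size (inradius_num ('X : {poly S})) <= 9)%N.
Proof.
apply: (@size_le_coefs _ _ [:: 0; - (9 * 36); - 27; 9]) => //.
by rewrite /= !cons_poly_def mul0r add0r /inradius_num; ring.
Qed.

Lemma size_inradius_den (S : comNzRingType) : (size (inradius_den ('X : {poly S})) <= 9)%N.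
Proof.
apply: (@size_le_coefs _ _ [:: 14 * 270; - (14 * 45); - (14 * 6); 14]) => //.
by rewrite /= !cons_poly_def mul0r add0r /inradius_den; ring.
Qed.

Lemma inradius_not_expressible : ~ (exists f : radical_formula, expresses f (@is_inradius R)).
Proof.
case=> f fQ; have [y [r [t [Fy [bis rt] rel _ _]]]] := triangle_2_3_6 R.
apply: (@root_relation_not_solvable y r inradius_num inradius_den _ _ _ _ _ _ Fy rel
  (expresses_solvable fQ bis rt)).
- by move=> S T g x; rewrite /inradius_num !(rmorphB, rmorphM, rmorphXn, rmorph_nat).
- by move=> S T g x; rewrite /inradius_den !(rmorphB, rmorphM, rmorphXn, rmorph_nat).
- exact: size_inradius_num.
- exact: size_inradius_den.
- by rewrite /inradius_den; ring.
have -> : inradius_num (6 : rat) = - (9 * 108)%N%:R by rewrite natrM /inradius_num; ring.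
by rewrite oppr_eq0 pnatr_eq0 muln_eq0.
Qed.

Definition area_num (S : comNzRingType) (x : S) := 9 * (x * (x ^+ 2 - 3 * x - 36)) ^+ 2.
Definition area_den (S : comNzRingType) (x : S) := 196 * (x - 6) ^+ 2 * (x ^+ 2 - 45).

Lemma size_area_num (S : comNzRingType) : (size (area_num ('X : {poly S})) <= 9)%N.
Proof.
apply: (@size_le_coefs _ _ [:: 0; 0; 9 * 1296; 9 * 216; - (9 * 63); - (9 * 6); 9]) => //.
by rewrite /= !cons_poly_def mul0r add0r /area_num; ring.
Qed.

Lemma size_area_den (S : comNzRingType) : (size (area_den ('X : {poly S})) <= 9)%N.
Proof.
apply: (@size_le_coefs _ _ [:: - (196 * 1620); 196 * 540; - (196 * 9); - (196 * 12); 196]) => //.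
by rewrite /= !cons_poly_def mul0r add0r /area_den; ring.
Qed.

Lemma area_not_expressible : ~ (exists f : radical_formula, expresses f (@is_area R)).
Proof.
case=> f fQ; have [y [r [t [Fy [bis _] _ rel _]]]] := triangle_2_3_6 R.
apply: (@root_relation_not_solvable y (area t) area_num area_den _ _ _ _ _ _ Fy rel
  (expresses_solvable fQ bis (erefl : is_area t (area t)))).
- by move=> S T g x; rewrite /area_num !(rmorphB, rmorphM, rmorphXn, rmorph_nat).
- by move=> S T g x; rewrite /area_den !(rmorphB, rmorphM, rmorphXn, rmorph_nat).
- exact: size_area_num.
- exact: size_area_den.
- by rewrite /area_den; ring.
have -> : area_num (6 : rat) = (9 * 108 * 108)%N%:R by rewrite !natrM /area_num; ring.
by rewrite pnatr_eq0 !muln_eq0.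
Qed.

Definition perimeter_num (S : comNzRingType) (x : S) := 2 * (x * (x ^+ 2 - 3 * x - 36)).
Definition perimeter_den (S : comNzRingType) (x : S) := 7 * (x - 6).

Lemma size_perimeter_num (S : comNzRingType) : (size (perimeter_num ('X : {poly S})) <= 9)%N.
Proof.
apply: (@size_le_coefs _ _ [:: 0; - 72; - 6; 2]) => //.
by rewrite /= !cons_poly_def mul0r add0r /perimeter_num; ring.
Qed.

Lemma size_perimeter_den (S : comNzRingType) : (size (perimeter_den ('X : {poly S})) <= 9)%N.
Proof.
apply: (@size_le_coefs _ _ [:: - 42; 7]) => //.
by rewrite /= !cons_poly_def mul0r add0r /perimeter_den; ring.
Qed.

Lemma perimeter_not_expressible : ~ (exists f : radical_formula, expresses f (@is_perimeter R)).
Proof.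
case=> f fQ; have [y [r [t [Fy [bis _] _ _ rel]]]] := triangle_2_3_6 R.
apply: (@root_relation_not_solvable y (perimeter t) perimeter_num perimeter_den _ _ _ _ _ _ Fy rel
  (expresses_solvable fQ bis (erefl : is_perimeter t (perimeter t)))).
- by move=> S T g x; rewrite /perimeter_num !(rmorphB, rmorphM, rmorphXn, rmorph_nat).
- by move=> S T g x; rewrite /perimeter_den !(rmorphB, rmorphM, rmorphXn, rmorph_nat).
- exact: size_perimeter_num.
- exact: size_perimeter_den.
- by rewrite /perimeter_den; ring.
have -> : perimeter_num (6 : rat) = - (2 * 108)%N%:R by rewrite natrM /perimeter_num; ring.
by rewrite oppr_eq0 pnatr_eq0 muln_eq0.
Qed.

End NotExpressible.

Theorem theorem2 (R : realType) :
  [/\ ~ (exists f : radical_formula, expresses f (@is_inradius R)),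
      ~ (exists f : radical_formula, expresses f (@is_area R)) &
      ~ (exists f : radical_formula, expresses f (@is_perimeter R))].
Proof.
by split; [apply: inradius_not_expressible | apply: area_not_expressible |
           apply: perimeter_not_expressible].
Qed.
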